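(* Let $n\geqslant 2$ and let $A$ be a convex body in $\mathbb{R}^n$. Then for any pair of convex bodies $K_1,K_2$ in $\mathbb{R}^n$, $$|A|\,V(K_1,K_2,A[n-2])\leqslant 2\,V(K_1,A[n-1])\,V(K_2,A[n-1]).$$ *)

(* Defs.v *)
From Stdlib Require Import Arith Reals List Classical ClassicalEpsilon.
Open Scope R_scope.

(* Points of R^n are represented as functions nat -> R whose coordinates
   of index >= n vanish; a set is a predicate on such functions. *)
Definition point := nat -> R.
Definition pset := point -> Prop.

Definition in_space (n : nat) (x : point) : Prop :=
  forall i, (n <= i)%nat -> x i = 0.

Definition padd (x y : point) : point := fun i => x i + y i.
Definition pscal (t : R) (x : point) : point := fun i => t * x i.
Definition origin : point := fun _ => 0.

Definition msum (K L : pset) : pset :=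
  fun z => exists x y, K x /\ L y /\ z = padd x y.
Definition singleton0 : pset := fun z => z = origin.

Definition convex (K : pset) : Prop :=
  forall x y t, K x -> K y -> 0 <= t <= 1 ->
    K (padd (pscal (1 - t) x) (pscal t y)).

Definition bounded (n : nat) (K : pset) : Prop :=
  exists M, forall x, K x -> forall i, (i < n)%nat -> Rabs (x i) <= M.

(* closed: limits (coordinatewise, equivalently Euclidean in R^n) of
   sequences in K lie in K *)
Definition closed_set (K : pset) : Prop :=
  forall (u : nat -> point) (x : point),
    (forall k, K (u k)) -> (forall i, Un_cv (fun k => u k i) (x i)) -> K x.

Definition convex_body (n : nat) (K : pset) : Prop :=
  (forall x, K x -> in_space n x) /\ (exists x, K x) /\
  convex K /\ bounded n K /\ closed_set K.

Definition is_glb (E : R -> Prop) (m : R) : Prop :=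
  (forall x, E x -> m <= x) /\ (forall m', (forall x, E x -> m' <= x) -> m' <= m).
Definition Rinf (E : R -> Prop) : R := epsilon (inhabits 0) (is_glb E).

Definition box_ok (n : nat) (ab : point * point) : Prop :=
  forall i, (i < n)%nat -> fst ab i <= snd ab i.
Definition box_vol (n : nat) (ab : point * point) : R :=
  fold_right Rmult 1 (map (fun i => snd ab i - fst ab i) (seq 0 n)).
Definition in_box (n : nat) (ab : point * point) (x : point) : Prop :=
  forall i, (i < n)%nat -> fst ab i <= x i <= snd ab i.

(* n-dimensional volume (Lebesgue measure) of a compact set: infimum of the
   total volume of finite box covers *)
Definition volume (n : nat) (K : pset) : R :=
  Rinf (fun v => exists bs : list (point * point),
          Forall (box_ok n) bs /\
          (forall x, K x -> Exists (fun ab => in_box n ab x) bs) /\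
          v = fold_right Rplus 0 (map (box_vol n) bs)).

Fixpoint mv_aux (n : nat) (Ks : list pset) (acc : pset) (k : nat) : R :=
  match Ks with
  | nil => (-1) ^ k * volume n acc
  | K :: Ks' => mv_aux n Ks' (msum acc K) k + mv_aux n Ks' acc (S k)
  end.

(* mixed volume V(K_1,...,K_n) via the polarization formula
   V(K_1,..,K_n) = 1/n! * sum_{S ⊆ [n]} (-1)^(n-|S|) |sum_{i in S} K_i| *)
Definition mixed_volume (n : nat) (Ks : list pset) : R :=
  / INR (fact n) * mv_aux n Ks singleton0 0.

(* Main.v *)
(* Write f(x, y, z) = |x K1 + y K2 + z A|.

   f is a homogeneous polynomial with nonnegative coefficients.  Let V_i be the lattice points
   within distance 1 of M K_i.  The number of elements of the sumset k(x V_1 + y V_2 + z V_3)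
   is, up to a bounded shift of the multiplicities, a sum of products of binomial coefficients
   (Khovanskii's theorem), and it agrees with (k M)^n f(x, y, z) up to a relative error
   O(1/M) as k tends to infinity; so f is a limit of polynomials with nonnegative coefficients.

   The polarization formula extracts the coefficients of z^n, x z^(n-1), y z^(n-1) and
   x y z^(n-2), which are therefore |A|, n V(K1,A[n-1]), n V(K2,A[n-1]) and
   n(n-1) V(K1,K2,A[n-2]).  The Brunn-Minkowski inequality |jA + L|^(1/n) >= j|A|^(1/n) + |L|^(1/n)
   with j tending to infinity is Minkowski's first inequality; applied to
   L = x K1 + y K2 + m A with m tending to infinity it gives Minkowski's second inequality
   V(L',A[n-1])^2 >= |A| V(L',L',A[n-2]) for L' = x K1 + y K2.  Dropping the nonnegative terms
   V(K_i,K_i,A[n-2]) and choosing x : y = V(K2,A[n-1]) : V(K1,A[n-1]) gives the claim. *)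

From Coquelicot Require Import Coquelicot.
From Stdlib Require Import Arith Reals List Lia Lra ZArith.
From Stdlib Require Import FunctionalExtensionality PropExtensionality Classical ClassicalEpsilon.
From Stdlib Require FinFun.
Require Import Defs.
Open Scope R_scope.

(** Only integer multiplicities [tri -> nat] occur. Polarization and both limits of Brunn-Minkowski
    need nothing more, and repeated Minkowski sums replace dilations by reals.

    The obstacle is that [volume] is a bare infimum over finite box covers, with no additivity or
    scaling laws at hand. Counting lattice points supplies the substitutes: comparing a box with its
    covers, bounding a sumset by a cover, and the polynomial itself all reduce to counts. Signs come
    for free, because each cell contributes a product of binomials with positive leading
    coefficient, and a finitely generated cone of functions is closed under pointwise limits. The
    generators depend on the mesh [M], so k tends to infinity first with [M] fixed, leaving a
    relative error that does not see k; only then does [M] grow.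

    The constant 2: with x = V(K2,A[n-1]) and y = V(K1,A[n-1]), the square of x V(K1,A[n-1]) + y
    V(K2,A[n-1]) is 4 (xy)^2, while the mixed term kept on the other side is 2 xy |A|
    V(K1,K2,A[n-2]), and xy = V(K1,A[n-1]) V(K2,A[n-1]). *)

(** * Finite sums and products, and their limits *)

Definition lsum {X : Type} (f : X -> R) (l : list X) : R :=
  fold_right Rplus 0 (map f l).

Lemma lsum_cons {X} (f : X -> R) a l : lsum f (a :: l) = f a + lsum f l.
Proof. reflexivity. Qed.

Lemma lsum_app {X} (f : X -> R) l1 l2 : lsum f (l1 ++ l2) = lsum f l1 + lsum f l2.
Proof.
  induction l1 as [|a l1 IH]; simpl; [unfold lsum at 2; simpl; lra|].
  rewrite !lsum_cons, IH; lra.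
Qed.

Lemma lsum_map {X Y} (g : X -> Y) (f : Y -> R) l :
  lsum f (map g l) = lsum (fun x => f (g x)) l.
Proof. unfold lsum; now rewrite map_map. Qed.

Lemma lsum_ext {X} (f g : X -> R) l :
  (forall x, In x l -> f x = g x) -> lsum f l = lsum g l.
Proof. intros H; unfold lsum; f_equal; now apply map_ext_in. Qed.

Lemma lsum_le {X} (f g : X -> R) l :
  (forall x, In x l -> f x <= g x) -> lsum f l <= lsum g l.
Proof.
  induction l as [|a l IH]; intros H; [apply Rle_refl|].
  rewrite !lsum_cons; apply Rplus_le_compat; [apply H; now left|].
  apply IH; intros; apply H; now right.
Qed.

Lemma lsum_nonneg {X} (f : X -> R) l :
  (forall x, In x l -> 0 <= f x) -> 0 <= lsum f l.
Proof.
  intros H; induction l as [|a l IH]; [apply Rle_refl|].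
  rewrite lsum_cons; apply Rplus_le_le_0_compat; [apply H; now left|].
  apply IH; intros; apply H; now right.
Qed.

Lemma lsum_plus {X} (f g : X -> R) l :
  lsum (fun x => f x + g x) l = lsum f l + lsum g l.
Proof.
  induction l as [|a l IH]; [unfold lsum; simpl; lra|].
  rewrite !lsum_cons, IH; lra.
Qed.

Lemma lsum_scal {X} c (f : X -> R) l : lsum (fun x => c * f x) l = c * lsum f l.
Proof.
  induction l as [|a l IH]; [unfold lsum; simpl; lra|].
  rewrite !lsum_cons, IH; lra.
Qed.

Lemma lsum_const {X} c (l : list X) : lsum (fun _ => c) l = INR (length l) * c.
Proof.
  induction l as [|a l IH]; [unfold lsum; simpl; lra|].
  rewrite lsum_cons, IH. change (length (a :: l)) with (S (length l)).
  rewrite S_INR; lra.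
Qed.

Lemma lim_lsum {X} (f : nat -> X -> R) (g : X -> R) l :
  (forall x, In x l -> is_lim_seq (fun k => f k x) (g x)) ->
  is_lim_seq (fun k => lsum (f k) l) (lsum g l).
Proof.
  induction l as [|a l IH]; intros H; [apply is_lim_seq_const|].
  apply is_lim_seq_plus' with (u := fun k => f k a) (v := fun k => lsum (f k) l).
  - apply H; now left.
  - apply IH; intros; apply H; now right.
Qed.

Definition prodn (n : nat) (f : nat -> R) : R :=
  fold_right Rmult 1 (map f (seq 0 n)).

Lemma prodn_S n f : prodn (S n) f = prodn n f * f n.
Proof.
  unfold prodn; rewrite seq_S, map_app, fold_right_app; simpl.
  rewrite Rmult_1_r.
  generalize (map f (seq 0 n)); intros l.
  induction l as [|a l IH]; simpl; [lra|]. rewrite IH; lra.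
Qed.

Lemma prodn_ext n f g : (forall i, (i < n)%nat -> f i = g i) -> prodn n f = prodn n g.
Proof.
  induction n as [|n IH]; intros H; [reflexivity|].
  rewrite !prodn_S, IH, H; auto with arith.
Qed.

Lemma prodn_nonneg n f : (forall i, (i < n)%nat -> 0 <= f i) -> 0 <= prodn n f.
Proof.
  induction n as [|n IH]; intros H; [unfold prodn; simpl; lra|].
  rewrite prodn_S; apply Rmult_le_pos; auto with arith.
Qed.

Lemma prodn_pos n f : (forall i, (i < n)%nat -> 0 < f i) -> 0 < prodn n f.
Proof.
  induction n as [|n IH]; intros H; [unfold prodn; simpl; lra|].
  rewrite prodn_S; apply Rmult_lt_0_compat; auto with arith.
Qed.

Lemma prodn_le n f g : (forall i, (i < n)%nat -> 0 <= f i <= g i) -> prodn n f <= prodn n g.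
Proof.
  induction n as [|n IH]; intros H; [unfold prodn; simpl; lra|].
  rewrite !prodn_S; apply Rmult_le_compat.
  - apply prodn_nonneg; intros; apply H; lia.
  - apply H; lia.
  - apply IH; intros; apply H; lia.
  - apply H; lia.
Qed.

Lemma prodn_scal n c f : prodn n (fun i => c * f i) = c ^ n * prodn n f.
Proof.
  induction n as [|n IH]; [unfold prodn; simpl; lra|].
  rewrite !prodn_S, IH; simpl; ring.
Qed.

Lemma prodn_const n c : prodn n (fun _ => c) = c ^ n.
Proof.
  induction n as [|n IH]; [reflexivity|]. rewrite prodn_S, IH; simpl; ring.
Qed.

Lemma prodn_zero n f i : (i < n)%nat -> f i = 0 -> prodn n f = 0.
Proof.
  induction n as [|n IH]; intros Hi H; [lia|]. rewrite prodn_S.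
  destruct (Nat.eq_dec i n) as [->|]; [rewrite H; lra|]. rewrite IH; [lra|lia|easy].
Qed.

(** [W] is the product of the factors other than the i-th. It does not depend on [g], so a single
    [W] serves a box and both halves of any cut across direction i. *)
Lemma prodn_factor n f i : (i < n)%nat ->
  exists W, forall g, (forall j, (j < n)%nat -> j <> i -> g j = f j) ->
    prodn n g = g i * W.
Proof.
  induction n as [|n IH]; intros Hi; [lia|].
  destruct (Nat.eq_dec i n) as [->|Hn].
  - exists (prodn n f); intros g Hg; rewrite prodn_S, (prodn_ext n g f); [ring|].
    intros j Hj; apply Hg; lia.
  - destruct IH as [W HW]; [lia|]. exists (W * f n); intros g Hg.
    rewrite prodn_S, HW, (Hg n); [ring|lia|lia|].
    intros; apply Hg; lia.
Qed.

Lemma lim_prodn n (f : nat -> nat -> R) (g : nat -> R) :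
  (forall i, (i < n)%nat -> is_lim_seq (fun k => f k i) (g i)) ->
  is_lim_seq (fun k => prodn n (f k)) (prodn n g).
Proof.
  induction n as [|n IH]; intros H; [apply is_lim_seq_const|].
  rewrite prodn_S. apply is_lim_seq_ext with (u := fun k => prodn n (f k) * f k n).
  - intros; now rewrite prodn_S.
  - apply is_lim_seq_mult'; auto with arith.
Qed.

(** Sequences run over [S k] so that no denominator vanishes; all later error terms have this
    form. *)
Lemma lim_const_div (c : R) : is_lim_seq (fun k => c / INR (S k)) 0.
Proof.
  apply is_lim_seq_ext with (u := fun k => c * / INR (S k)); [reflexivity|].
  replace (Finite 0) with (Rbar_mult c 0) by (simpl; f_equal; ring).
  apply is_lim_seq_scal_l.
  apply (is_lim_seq_incr_1 (fun k => / INR k)).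
  replace (Finite 0) with (Rbar_inv p_infty) by reflexivity.
  apply is_lim_seq_inv; [apply is_lim_seq_INR|discriminate].
Qed.

Lemma lim_affine_div (a c : R) : is_lim_seq (fun k => a + c / INR (S k)) a.
Proof.
  replace (Finite a) with (Finite (a + 0)) by (f_equal; ring).
  apply is_lim_seq_plus'; [apply is_lim_seq_const|apply lim_const_div].
Qed.

Lemma lim_le_const (u : nat -> R) (l c : R) :
  is_lim_seq u l -> (forall k, c <= u k) -> c <= l.
Proof.
  intros Hu H.
  apply (is_lim_seq_le (fun _ => c) u c l H (is_lim_seq_const c) Hu).
Qed.

(** * Lattice points in boxes *)

Definition ipoint := nat -> Z.

(** [- Int_part (- lo)] is the ceiling of [lo]. If the interval contains no integer, [Z.to_nat]
    truncates a nonpositive length to 0. *)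
Definition zrange (lo hi : R) : list Z :=
  map (fun t => (- Int_part (- lo) + Z.of_nat t)%Z)
      (seq 0 (Z.to_nat (Int_part hi + Int_part (- lo) + 1))).

Lemma le_Int_part (r : R) (z : Z) : (z <= Int_part r)%Z <-> IZR z <= r.
Proof.
  destruct (base_Int_part r) as [H1 H2]; split; intros H.
  - apply IZR_le in H; lra.
  - assert (IZR z < IZR (Int_part r) + 1) by lra.
    rewrite <- plus_IZR in H0; apply lt_IZR in H0; lia.
Qed.

Lemma in_zrange lo hi z : In z (zrange lo hi) <-> lo <= IZR z <= hi.
Proof.
  unfold zrange; rewrite in_map_iff.
  pose proof (le_Int_part hi z) as Hh. pose proof (le_Int_part (- lo) (- z)) as Hl.
  rewrite opp_IZR in Hl.
  split.
  - intros [t [<- Ht]]; apply in_seq in Ht; split.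
    + assert (- IZR (- Int_part (- lo) + Z.of_nat t) <= - lo) by (apply Hl; lia); lra.
    + apply Hh; lia.
  - intros [H1 H2].
    assert (z <= Int_part hi)%Z by (apply Hh; lra).
    assert (- z <= Int_part (- lo))%Z by (apply Hl; lra).
    exists (Z.to_nat (z + Int_part (- lo))); split; [lia|apply in_seq; lia].
Qed.

Lemma zrange_NoDup lo hi : NoDup (zrange lo hi).
Proof.
  apply FinFun.Injective_map_NoDup; [intros a b H; lia|apply seq_NoDup].
Qed.

Lemma zrange_length lo hi : lo <= hi ->
  hi - lo - 1 <= INR (length (zrange lo hi)) <= hi - lo + 1.
Proof.
  intros H; unfold zrange; rewrite length_map, length_seq.
  destruct (base_Int_part hi) as [H1 H2], (base_Int_part (- lo)) as [H3 H4].
  rewrite INR_IZR_INZ.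
  set (s := (Int_part hi + Int_part (- lo) + 1)%Z).
  assert (Hs : IZR s = IZR (Int_part hi) + IZR (Int_part (- lo)) + 1)
    by (unfold s; rewrite !plus_IZR; ring).
  (* [s] is an integer exceeding -1, so [Z.to_nat] truncates nothing. *)
  assert (0 <= s)%Z.
  { assert (-1 < IZR s) by lra. apply lt_IZR in H0; lia. }
  rewrite Z2Nat.id by assumption. lra.
Qed.

Definition upd {X : Type} (w : nat -> X) (n : nat) (z : X) : nat -> X :=
  fun i => if Nat.eq_dec i n then z else w i.

Lemma upd_eq {X} (w : nat -> X) n z : upd w n z n = z.
Proof. unfold upd; now destruct (Nat.eq_dec n n). Qed.

Lemma upd_neq {X} (w : nat -> X) n z i : i <> n -> upd w n z i = w i.
Proof. unfold upd; now destruct (Nat.eq_dec i n). Qed.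

Definition supported (n : nat) (z : ipoint) : Prop := forall i, (n <= i)%nat -> z i = 0%Z.

Fixpoint grid (n : nat) (lo hi : nat -> R) : list ipoint :=
  match n with
  | O => (fun _ => 0%Z) :: nil
  | S n => flat_map (fun z => map (fun w => upd w n z) (grid n lo hi)) (zrange (lo n) (hi n))
  end.

Lemma in_grid n lo hi z :
  In z (grid n lo hi) <-> supported n z /\ forall i, (i < n)%nat -> lo i <= IZR (z i) <= hi i.
Proof.
  revert z; induction n as [|n IH]; intros z; simpl.
  - split.
    + intros [<-|[]]; split; [intros i _; reflexivity|intros; lia].
    + intros [H _]; left; apply functional_extensionality; intros i; symmetry; apply H; lia.
  - rewrite in_flat_map; split.
    + intros [a [Ha Hw]]. apply in_map_iff in Hw. destruct Hw as [w [<- Hw]].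
      apply IH in Hw; destruct Hw as [Hs Hw]. apply in_zrange in Ha. split.
      * intros i Hi; rewrite upd_neq by lia; apply Hs; lia.
      * intros i Hi; destruct (Nat.eq_dec i n) as [->|Hn].
        -- now rewrite upd_eq.
        -- rewrite upd_neq by assumption; apply Hw; lia.
    + intros [Hs Hz]; exists (z n); split; [apply in_zrange, Hz; lia|].
      apply in_map_iff; exists (upd z n 0%Z); split.
      * apply functional_extensionality; intros i; unfold upd.
        destruct (Nat.eq_dec i n) as [->|]; reflexivity.
      * apply IH; split.
        -- intros i Hi; destruct (Nat.eq_dec i n) as [->|]; [apply upd_eq|].
           rewrite upd_neq by assumption; apply Hs; lia.
        -- intros i Hi; rewrite upd_neq by lia; apply Hz; lia.
Qed.

Lemma grid_length n lo hi :
  INR (length (grid n lo hi)) = prodn n (fun i => INR (length (zrange (lo i) (hi i)))).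
Proof.
  induction n as [|n IH]; [reflexivity|].
  rewrite prodn_S, <- IH, <- mult_INR; f_equal; simpl.
  rewrite Nat.mul_comm.
  generalize (zrange (lo n) (hi n)); intros l; induction l as [|a l IHl]; [reflexivity|].
  simpl; rewrite length_app, length_map; f_equal; exact IHl.
Qed.

Lemma grid_length_le n lo hi : (forall i, (i < n)%nat -> lo i <= hi i) ->
  INR (length (grid n lo hi)) <= prodn n (fun i => hi i - lo i + 1).
Proof.
  intros H; rewrite grid_length; apply prodn_le; intros i Hi; split; [apply pos_INR|].
  now apply zrange_length, H.
Qed.

Lemma grid_NoDup n lo hi : NoDup (grid n lo hi).
Proof.
  induction n as [|n IH]; simpl; [repeat constructor; easy|].
  pose proof (zrange_NoDup (lo n) (hi n)) as Hz.
  induction Hz as [|a l Ha Hl IHl]; simpl; [constructor|].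
  apply NoDup_app; [|exact IHl|].
  - apply FinFun.Injective_map_NoDup_in; [|exact IH].
    intros u v Hu Hv E. apply in_grid in Hu, Hv.
    apply functional_extensionality; intros i.
    destruct (Nat.eq_dec i n) as [->|Hi].
    + destruct Hu as [Hu _], Hv as [Hv _]; rewrite Hu, Hv; lia.
    + apply (f_equal (fun w => w i)) in E. now rewrite !upd_neq in E.
  - intros u Hu Hu'. apply in_map_iff in Hu; destruct Hu as [u0 [<- _]].
    apply in_flat_map in Hu'; destruct Hu' as [b [Hb Hb']].
    apply in_map_iff in Hb'; destruct Hb' as [v [E _]].
    apply (f_equal (fun w => w n)) in E; rewrite !upd_eq in E; congruence.
Qed.

(** * Volume as an infimum over box covers *)

Definition covers (n : nat) (bs : list (point * point)) (K : pset) : Prop :=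
  forall x, K x -> Exists (fun ab => in_box n ab x) bs.

Definition boxes_vol (n : nat) (bs : list (point * point)) : R := lsum (box_vol n) bs.

Lemma box_vol_nonneg n ab : box_ok n ab -> 0 <= box_vol n ab.
Proof.
  intros H; apply prodn_nonneg; intros i Hi; specialize (H i Hi); simpl; lra.
Qed.

(** [Rinf] is a choice by [epsilon], so it means something only once an infimum is shown to exist:
    the set of values is bounded below by 0, and nonempty because of one large box. Completeness is
    applied to the negated set. *)
Lemma volume_glb n K : bounded n K ->
  is_glb (fun v => exists bs, Forall (box_ok n) bs /\ covers n bs K /\ v = boxes_vol n bs)
         (volume n K).
Proof.
  intros [M HM]; unfold volume, Rinf.
  apply (epsilon_spec (inhabits 0)
    (is_glb (fun v => exists bs, Forall (box_ok n) bs /\ covers n bs K /\ v = boxes_vol n bs))).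
  set (E := fun v => exists bs, Forall (box_ok n) bs /\ covers n bs K /\ v = boxes_vol n bs).
  destruct (completeness (fun v => E (- v))) as [m [Hm1 Hm2]].
  - exists 0; intros v [bs [Hok [_ Hv]]].
    assert (0 <= boxes_vol n bs).
    { apply lsum_nonneg; intros ab Hab; apply box_vol_nonneg.
      rewrite Forall_forall in Hok; auto. }
    lra.
  (* [Rabs M] rather than [M]: the bound may be negative when it constrains nothing. *)
  - set (b := ((fun _ => - Rabs M), (fun _ => Rabs M)) : point * point).
    exists (- boxes_vol n (b :: nil)); unfold E; rewrite Ropp_involutive.
    exists (b :: nil); split; [|split; [|reflexivity]].
    + constructor; [|constructor]. intros i _; simpl. pose proof (Rabs_pos M); lra.
    + intros x Hx; constructor; intros i Hi; simpl.
      specialize (HM x Hx i Hi). pose proof (Rle_abs M).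
      apply Rabs_le_between; lra.
  - exists (- m); split.
    + intros v Hv. assert (- v <= m); [|lra]. apply Hm1; now rewrite Ropp_involutive.
    + intros m' Hm'. assert (m <= - m'); [|lra]. apply Hm2; intros v Hv.
      specialize (Hm' _ Hv); lra.
Qed.

Lemma volume_le_cover n K bs : bounded n K -> Forall (box_ok n) bs -> covers n bs K ->
  volume n K <= boxes_vol n bs.
Proof. intros HK H1 H2; apply (volume_glb n K HK); eauto. Qed.

Lemma le_volume n K c : bounded n K ->
  (forall bs, Forall (box_ok n) bs -> covers n bs K -> c <= boxes_vol n bs) ->
  c <= volume n K.
Proof.
  intros HK H; apply (volume_glb n K HK); intros v [bs [H1 [H2 ->]]]; auto.
Qed.

Lemma volume_cover_approx n K eps : bounded n K -> 0 < eps ->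
  exists bs, Forall (box_ok n) bs /\ covers n bs K /\ boxes_vol n bs < volume n K + eps.
Proof.
  intros HK He; apply NNPP; intros H.
  assert (volume n K + eps <= volume n K); [|lra].
  apply le_volume; [exact HK|]; intros bs H1 H2.
  apply Rnot_lt_le; intros H3; apply H; eauto.
Qed.

Definition cube (T : R) (z : ipoint) : point * point :=
  ((fun i => IZR (z i) / T), (fun i => (IZR (z i) + 1) / T)).

Lemma cube_lt n T z i : 0 < T -> (i < n)%nat -> fst (cube T z) i < snd (cube T z) i.
Proof.
  intros HT _; simpl. apply Rmult_lt_compat_r; [now apply Rinv_0_lt_compat|lra].
Qed.

Lemma cubes_vol n T zs : 0 < T -> boxes_vol n (map (cube T) zs) = INR (length zs) / T ^ n.
Proof.
  intros HT; unfold boxes_vol; rewrite lsum_map, (lsum_ext _ (fun _ => / T ^ n)).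
  - now rewrite lsum_const.
  - intros z _; unfold box_vol; rewrite <- pow_inv.
    rewrite <- prodn_const; apply prodn_ext; intros i _; simpl. field; lra.
Qed.

Lemma cubes_ok n T zs : 0 < T -> Forall (box_ok n) (map (cube T) zs).
Proof.
  intros HT; apply Forall_forall; intros ab Hab; apply in_map_iff in Hab.
  destruct Hab as [z [<- _]]; intros i Hi. now apply Rlt_le, cube_lt with n.
Qed.

Definition floor_pt (n : nat) (T : R) (x : point) : ipoint :=
  fun i => if lt_dec i n then Int_part (T * x i) else 0%Z.

Lemma floor_pt_supported n T x : supported n (floor_pt n T x).
Proof. intros i Hi; unfold floor_pt; destruct (lt_dec i n); [lia|reflexivity]. Qed.

Lemma floor_pt_spec n T x i : (i < n)%nat ->
  T * x i - 1 < IZR (floor_pt n T x i) <= T * x i.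
Proof.
  intros Hi; unfold floor_pt; destruct (lt_dec i n); [|lia].
  destruct (base_Int_part (T * x i)); lra.
Qed.

Lemma floor_pt_cube n T x : 0 < T -> in_box n (cube T (floor_pt n T x)) x.
Proof.
  intros HT i Hi; simpl. pose proof (floor_pt_spec n T x i Hi) as H.
  split; [apply Rmult_le_reg_l with T|apply Rmult_le_reg_l with T]; try assumption;
    field_simplify; lra.
Qed.

(** A side of length l, scaled by [T] and widened by [e] at both ends, holds at most l T + 2 e + 1
    integers. Division by [T] turns this into l + (2 e + 1)/T, and every point of [zs] is charged to
    some box. *)
Lemma count_in_boxes n (zs : list ipoint) (bs : list (point * point)) (T e : R) :
  0 < T -> 0 <= e -> NoDup zs -> Forall (box_ok n) bs ->
  (forall z, In z zs -> supported n z /\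
     Exists (fun ab => forall i, (i < n)%nat ->
       T * fst ab i - e <= IZR (z i) <= T * snd ab i + e) bs) ->
  INR (length zs) / T ^ n <= lsum (fun ab => prodn n (fun i => snd ab i - fst ab i + (2 * e + 1) / T)) bs.
Proof.
  intros HT He Hnd Hok H.
  set (g := fun ab : point * point =>
     grid n (fun i => T * fst ab i - e) (fun i => T * snd ab i + e)).
  assert (Hl : (length zs <= length (flat_map g bs))%nat).
  { apply NoDup_incl_length; [exact Hnd|]. intros z Hz.
    destruct (H z Hz) as [Hs He']. apply Exists_exists in He'. destruct He' as [ab [Hab Hz']].
    apply in_flat_map; exists ab; split; [exact Hab|]. apply in_grid; auto. }
  assert (HTn : 0 < T ^ n) by now apply pow_lt.
  apply Rle_trans with (INR (length (flat_map g bs)) / T ^ n).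
  { apply Rmult_le_compat_r; [now apply Rlt_le, Rinv_0_lt_compat|now apply le_INR]. }
  clear Hl H Hnd.
  induction Hok as [|ab bs Hab Hok IH].
  - simpl; unfold lsum; simpl; unfold Rdiv; rewrite Rmult_0_l; lra.
  - simpl flat_map; rewrite length_app, plus_INR, lsum_cons.
    unfold Rdiv; rewrite Rmult_plus_distr_r; apply Rplus_le_compat; [|exact IH].
    apply Rle_trans with (prodn n (fun i => T * snd ab i + e - (T * fst ab i - e) + 1) * / T ^ n).
    + apply Rmult_le_compat_r; [now apply Rlt_le, Rinv_0_lt_compat|].
      unfold g; apply grid_length_le; intros i Hi. specialize (Hab i Hi).
      assert (T * fst ab i <= T * snd ab i) by (apply Rmult_le_compat_l; lra). lra.
    + rewrite (prodn_ext n _ (fun i => T * (snd ab i - fst ab i + (2 * e + 1) * / T))).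
      * rewrite prodn_scal. rewrite (Rmult_comm (T ^ n)), Rmult_assoc, Rinv_r, Rmult_1_r by lra. apply Rle_refl.
      * intros i _; field; lra.
Qed.

(** * The Brunn-Minkowski inequality *)

(** This replaces additivity of volume: the points of the lattice of mesh 1/T in the box all lie in
    the cover, and both counts, divided by T^n, tend to the volumes. *)
Lemma box_le_cover n ab cs : box_ok n ab -> Forall (box_ok n) cs ->
  covers n cs (in_box n ab) -> box_vol n ab <= boxes_vol n cs.
Proof.
  intros Hab Hcs Hc.
  change (Rbar_le (box_vol n ab) (boxes_vol n cs)).
  apply (is_lim_seq_le
    (* The lower bound for the count may be negative on a short side; [Rmax 0] keeps the factors
       comparable and disappears in the limit. *)
    (fun k => prodn n (fun i => Rmax 0 (snd ab i - fst ab i + (-1) / INR (S k))))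
    (fun k => lsum (fun c => prodn n (fun i => snd c i - fst c i + (2 * 0 + 1) / INR (S k))) cs)).
  - intros k. set (T := INR (S k)). assert (HT : 0 < T) by (apply lt_0_INR; lia).
    apply Rle_trans with
      (INR (length (grid n (fun i => T * fst ab i) (fun i => T * snd ab i))) / T ^ n).
    + rewrite grid_length. unfold Rdiv at 2.
      rewrite <- pow_inv, Rmult_comm, <- prodn_scal.
      apply prodn_le; intros i Hi; split; [apply Rmax_l|].
      assert (Hl : T * fst ab i <= T * snd ab i)
        by (apply Rmult_le_compat_l; [lra|now apply Hab]).
      apply zrange_length in Hl; destruct Hl as [Hl _].
      assert (HTi : 0 < / T) by now apply Rinv_0_lt_compat.
      apply Rmax_lub; [apply Rmult_le_pos; [lra|apply pos_INR]|].
      apply Rle_trans with (/ T * (T * snd ab i - T * fst ab i - 1));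
        [right; field; lra|apply Rmult_le_compat_l; lra].
    + apply count_in_boxes; [exact HT|lra|apply grid_NoDup|exact Hcs|].
      intros z Hz; apply in_grid in Hz; destruct Hz as [Hs Hz]; split; [exact Hs|].
      assert (E : forall i, IZR (z i) = T * (IZR (z i) / T)) by (intros; field; lra).
      specialize (Hc (fun i => IZR (z i) / T)). apply Exists_exists in Hc.
      * destruct Hc as [c [Hc1 Hc2]]; apply Exists_exists; exists c; split; [exact Hc1|].
        intros i Hi; specialize (Hc2 i Hi); simpl in Hc2. rewrite (E i).
        rewrite Rminus_0_r, Rplus_0_r.
        split; apply Rmult_le_compat_l; try apply Hc2; lra.
      * intros i Hi; simpl; specialize (Hz i Hi); rewrite (E i) in Hz.
        split; apply Rmult_le_reg_l with T; try exact HT; apply Hz.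
  - apply lim_prodn; intros i Hi.
    apply is_lim_seq_le_le with (u := fun k => snd ab i - fst ab i + (-1) / INR (S k))
      (w := fun _ => snd ab i - fst ab i).
    + intros k; split; [apply Rmax_r|]. specialize (Hab i Hi).
      assert (0 < / INR (S k)) by (apply Rinv_0_lt_compat, lt_0_INR; lia).
      apply Rmax_lub; unfold Rdiv; lra.
    + apply lim_affine_div.
    + apply is_lim_seq_const.
  - apply lim_lsum; intros c _; apply lim_prodn; intros i _; apply lim_affine_div.
Qed.

(** * Brunn-Minkowski for two boxes, from AM-GM *)

Lemma exp_INR_mult n x : exp (INR n * x) = exp x ^ n.
Proof.
  induction n as [|n IH]; [rewrite Rmult_0_l; apply exp_0|].
  rewrite S_INR, Rmult_plus_distr_r, exp_plus, IH, Rmult_1_l; simpl; ring.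
Qed.

Lemma nth_root_exists n v : (1 <= n)%nat -> 0 <= v -> exists a, 0 <= a /\ a ^ n = v.
Proof.
  intros Hn [Hv|<-].
  - exists (exp (ln v / INR n)); split; [apply Rlt_le, exp_pos|].
    rewrite <- exp_INR_mult. replace (INR n * (ln v / INR n)) with (ln v).
    + now apply exp_ln.
    + field. apply not_0_INR; lia.
  - exists 0; split; [lra|]. apply pow_ne_zero; lia.
Qed.

Lemma prodn_le_exp n f : (forall i, (i < n)%nat -> 0 <= f i) ->
  prodn n f <= exp (lsum (fun i => f i - 1) (seq 0 n)).
Proof.
  induction n as [|n IH]; intros H.
  - unfold prodn, lsum; simpl. rewrite exp_0; lra.
  - rewrite prodn_S, seq_S, lsum_app, exp_plus. apply Rmult_le_compat.
    + apply prodn_nonneg; auto with arith.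
    + apply H; lia.
    + apply IH; auto with arith.
    + unfold lsum; simpl. rewrite Rplus_0_r.
      pose proof (exp_ineq1_le (f n - 1)); lra.
Qed.

(** Polya's proof: after division by the geometric mean [c] the product is 1, and t <= exp(t - 1)
    for each factor gives 1 <= exp of the sum of the f i / c - 1, so that sum is nonnegative. *)
Lemma AM_GM n c f : 0 < c -> (forall i, (i < n)%nat -> 0 <= f i) -> prodn n f = c ^ n ->
  INR n * c <= lsum f (seq 0 n).
Proof.
  intros Hc Hf E.
  pose proof (prodn_le_exp n (fun i => / c * f i)) as H.
  assert (Hci : 0 < / c) by now apply Rinv_0_lt_compat.
  rewrite prodn_scal, E, <- Rpow_mult_distr, Rinv_l, pow1 in H by lra.
  assert (H' : 1 <= exp (lsum (fun i => / c * f i - 1) (seq 0 n))).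
  { apply H; intros i Hi; apply Rmult_le_pos; [lra|auto]. }
  assert (H2 : 0 <= lsum (fun i => / c * f i - 1) (seq 0 n)).
  { apply Rnot_lt_le; intros H2; apply exp_increasing in H2; rewrite exp_0 in H2; lra. }
  unfold Rminus in H2.
  rewrite (lsum_plus (fun i => / c * f i) (fun _ => - (1))), lsum_scal, lsum_const, length_seq in H2.
  apply Rmult_le_reg_l with (/ c); [exact Hci|].
  replace (/ c * (INR n * c)) with (INR n) by (field; lra).
  change (lsum (fun i => f i) (seq 0 n)) with (lsum f (seq 0 n)) in H2. lra.
Qed.

Lemma prodn_mult n f g : prodn n (fun i => f i * g i) = prodn n f * prodn n g.
Proof.
  induction n as [|n IH]; [unfold prodn; simpl; ring|]. rewrite !prodn_S, IH; ring.
Qed.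

(** AM-GM is applied to the ratios a i / (a i + b i) and b i / (a i + b i), whose arithmetic means
    add up to 1. Stating the ratio of the products as [rho ^ n] avoids n-th roots. *)
Lemma prodn_superadditive n a b rho : (1 <= n)%nat -> 0 < rho ->
  (forall i, (i < n)%nat -> 0 < a i) -> (forall i, (i < n)%nat -> 0 < b i) ->
  prodn n b = rho ^ n * prodn n a ->
  (1 + rho) ^ n * prodn n a <= prodn n (fun i => a i + b i).
Proof.
  intros Hn Hr Ha Hb E.
  set (s := fun i => a i + b i).
  assert (Hs : forall i, (i < n)%nat -> 0 < s i)
    by (intros i Hi; unfold s; specialize (Ha i Hi); specialize (Hb i Hi); lra).
  set (u := fun i => a i * / s i). set (v := fun i => b i * / s i).
  assert (Hu : forall i, (i < n)%nat -> 0 < u i)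
    by (intros i Hi; apply Rmult_lt_0_compat; [auto|apply Rinv_0_lt_compat; auto]).
  assert (Hv : forall i, (i < n)%nat -> 0 < v i)
    by (intros i Hi; apply Rmult_lt_0_compat; [auto|apply Rinv_0_lt_compat; auto]).
  assert (Pu : 0 < prodn n u) by now apply prodn_pos.
  destruct (nth_root_exists n (prodn n u)) as [c [Hc Ec]]; [lia|lra|].
  assert (Hc' : 0 < c).
  { destruct Hc as [|<-]; [assumption|]. rewrite pow_ne_zero in Ec by lia; lra. }
  assert (Eu : prodn n a = prodn n u * prodn n s).
  { rewrite <- prodn_mult; apply prodn_ext; intros i Hi; unfold u.
    specialize (Hs i Hi); field; lra. }
  assert (Ev : prodn n b = prodn n v * prodn n s).
  { rewrite <- prodn_mult; apply prodn_ext; intros i Hi; unfold v.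
    specialize (Hs i Hi); field; lra. }
  assert (Ps : 0 < prodn n s) by now apply prodn_pos.
  assert (Ev' : prodn n v = (rho * c) ^ n).
  { rewrite Rpow_mult_distr, Ec. apply Rmult_eq_reg_r with (prodn n s); [|lra].
    rewrite <- Ev, E, Eu; ring. }
  pose proof (AM_GM n c u Hc' (fun i Hi => Rlt_le _ _ (Hu i Hi)) (eq_sym Ec)) as H1.
  pose proof (AM_GM n (rho * c) v (Rmult_lt_0_compat _ _ Hr Hc')
    (fun i Hi => Rlt_le _ _ (Hv i Hi)) Ev') as H2.
  assert (H3 : lsum u (seq 0 n) + lsum v (seq 0 n) = INR n).
  { rewrite <- lsum_plus, (lsum_ext _ (fun _ => 1)).
    - rewrite lsum_const, length_seq; ring.
    - intros i Hi; apply in_seq in Hi; unfold u, v.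
      assert (Hsi : 0 < s i) by (apply Hs; lia). unfold s in *; field; lra. }
  assert (HnR : 0 < INR n) by (apply lt_0_INR; lia).
  assert (H4 : (1 + rho) * c <= 1) by (apply Rmult_le_reg_l with (INR n); lra).
  rewrite Eu, <- Ec, <- Rmult_assoc, <- Rpow_mult_distr.
  rewrite <- (Rmult_1_l (prodn n s)) at 2.
  apply Rmult_le_compat_r; [lra|]. apply Rle_trans with (1 ^ n); [|rewrite pow1; lra].
  apply pow_incr; split; [|exact H4]. apply Rmult_le_pos; lra.
Qed.

(** * Cutting families of boxes by coordinate hyperplanes *)

(** Clamping keeps both halves valid boxes when the plane misses the box: one half is then the box
    itself and the other is flat. *)
Definition clamp (a b c : R) : R := Rmax a (Rmin b c).

Definition low (i : nat) (c : R) (ab : point * point) : point * point :=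
  (fst ab, upd (snd ab) i (clamp (fst ab i) (snd ab i) c)).

Definition up (i : nat) (c : R) (ab : point * point) : point * point :=
  (upd (fst ab) i (clamp (fst ab i) (snd ab i) c), snd ab).

Lemma clamp_between a b c : a <= b -> a <= clamp a b c <= b.
Proof.
  intros H; split; [apply Rmax_l|]. apply Rmax_lub; [exact H|apply Rmin_l].
Qed.

Lemma low_ok n i c ab : (i < n)%nat -> box_ok n ab -> box_ok n (low i c ab).
Proof.
  intros Hi H j Hj; simpl; destruct (Nat.eq_dec j i) as [->|].
  - rewrite upd_eq; apply clamp_between; auto.
  - rewrite upd_neq by assumption; auto.
Qed.

Lemma up_ok n i c ab : (i < n)%nat -> box_ok n ab -> box_ok n (up i c ab).
Proof.
  intros Hi H j Hj; simpl; destruct (Nat.eq_dec j i) as [->|].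
  - rewrite upd_eq; apply clamp_between; auto.
  - rewrite upd_neq by assumption; auto.
Qed.

Lemma split_vol_factor n i ab : (i < n)%nat -> exists W, forall c,
  box_vol n (low i c ab) = (clamp (fst ab i) (snd ab i) c - fst ab i) * W /\
  box_vol n (up i c ab) = (snd ab i - clamp (fst ab i) (snd ab i) c) * W /\
  box_vol n ab = (snd ab i - fst ab i) * W.
Proof.
  intros Hi; destruct (prodn_factor n (fun j => snd ab j - fst ab j) i Hi) as [W HW].
  exists W; intros c. unfold box_vol; fold (prodn n (fun j => snd ab j - fst ab j)).
  fold (prodn n (fun j => snd (low i c ab) j - fst (low i c ab) j)).
  fold (prodn n (fun j => snd (up i c ab) j - fst (up i c ab) j)).
  rewrite !HW; simpl; rewrite ?upd_eq; auto; intros j _ Hj; now rewrite upd_neq.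
Qed.

Lemma split_vol n i c ab : (i < n)%nat ->
  box_vol n (low i c ab) + box_vol n (up i c ab) = box_vol n ab.
Proof.
  intros Hi; destruct (split_vol_factor n i ab Hi) as [W HW].
  destruct (HW c) as [-> [-> ->]]; ring.
Qed.

Lemma in_low n i c ab x : in_box n ab x -> x i <= c -> in_box n (low i c ab) x.
Proof.
  intros H Hc j Hj; simpl; specialize (H j Hj); destruct (Nat.eq_dec j i) as [->|].
  - rewrite upd_eq; split; [lra|]. unfold clamp.
    eapply Rle_trans; [|apply Rmax_r]. apply Rmin_glb; lra.
  - now rewrite upd_neq.
Qed.

Lemma in_up n i c ab x : in_box n ab x -> c <= x i -> in_box n (up i c ab) x.
Proof.
  intros H Hc j Hj; simpl; specialize (H j Hj); destruct (Nat.eq_dec j i) as [->|].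
  - rewrite upd_eq; split; [|lra]. apply Rmax_lub; [lra|].
    eapply Rle_trans; [apply Rmin_r|exact Hc].
  - now rewrite upd_neq.
Qed.

(** A plane that misses a box leaves a flat half on the wrong side of the plane. Discarding flat
    boxes changes no volume, makes [low_sub] and [up_sub] true, and lets the number of boxes drop
    after a cut. *)
Definition box_nd (n : nat) (ab : point * point) : Prop :=
  forall i, (i < n)%nat -> fst ab i < snd ab i.

Definition nd_test (n : nat) (ab : point * point) : bool :=
  if excluded_middle_informative (box_nd n ab) then true else false.

Lemma nd_test_true n ab : nd_test n ab = true <-> box_nd n ab.
Proof. unfold nd_test; destruct excluded_middle_informative; split; easy. Qed.

Lemma nd_ok n ab : box_nd n ab -> box_ok n ab.
Proof. intros H i Hi; now apply Rlt_le, H. Qed.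

Lemma filter_nd_vol n bs : Forall (box_ok n) bs ->
  boxes_vol n (filter (nd_test n) bs) = boxes_vol n bs.
Proof.
  intros H; induction H as [|ab bs Hab Hbs IH]; [reflexivity|].
  simpl. unfold boxes_vol in *; rewrite lsum_cons, <- IH.
  destruct (nd_test n ab) eqn:E; [reflexivity|].
  assert (~ box_nd n ab) by (rewrite <- nd_test_true; congruence).
  assert (Hex : exists i, (i < n)%nat /\ snd ab i - fst ab i = 0).
  { apply NNPP; intros Hn; apply H; intros i Hi. specialize (Hab i Hi).
    destruct Hab as [Hab|Hab]; [exact Hab|]. exfalso; apply Hn; exists i; split; [exact Hi|lra]. }
  destruct Hex as [i [Hi Hz]].
  assert (E0 : box_vol n ab = 0) by exact (prodn_zero n _ i Hi Hz).
  rewrite E0; lra.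
Qed.

Definition lows n i c bs := filter (nd_test n) (map (low i c) bs).
Definition ups n i c bs := filter (nd_test n) (map (up i c) bs).

Lemma Forall_map_ok n (f : point * point -> point * point) bs :
  (forall ab, box_ok n ab -> box_ok n (f ab)) ->
  Forall (box_ok n) bs -> Forall (box_ok n) (map f bs).
Proof. intros Hf H; apply Forall_map; eapply Forall_impl; eauto. Qed.

Lemma lows_vol n i c bs : (i < n)%nat -> Forall (box_ok n) bs ->
  boxes_vol n (lows n i c bs) = lsum (fun ab => box_vol n (low i c ab)) bs.
Proof.
  intros Hi H; unfold lows; rewrite filter_nd_vol.
  - apply lsum_map.
  - apply Forall_map_ok; [|exact H]; intros; now apply low_ok.
Qed.

Lemma ups_vol n i c bs : (i < n)%nat -> Forall (box_ok n) bs ->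
  boxes_vol n (ups n i c bs) = lsum (fun ab => box_vol n (up i c ab)) bs.
Proof.
  intros Hi H; unfold ups; rewrite filter_nd_vol.
  - apply lsum_map.
  - apply Forall_map_ok; [|exact H]; intros; now apply up_ok.
Qed.

Lemma lows_ups_vol n i c bs : (i < n)%nat -> Forall (box_ok n) bs ->
  boxes_vol n (lows n i c bs) + boxes_vol n (ups n i c bs) = boxes_vol n bs.
Proof.
  intros Hi H; rewrite lows_vol, ups_vol by assumption.
  rewrite <- lsum_plus; apply lsum_ext; intros ab _; now apply split_vol.
Qed.

Lemma in_lows n i c bs ab : In ab (lows n i c bs) <->
  box_nd n ab /\ exists ab', ab = low i c ab' /\ In ab' bs.
Proof.
  unfold lows; rewrite filter_In, nd_test_true, in_map_iff. split.
  - intros [[x [<- Hx]] Hn]; eauto.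
  - intros [Hn [x [-> Hx]]]; eauto.
Qed.

Lemma in_ups n i c bs ab : In ab (ups n i c bs) <->
  box_nd n ab /\ exists ab', ab = up i c ab' /\ In ab' bs.
Proof.
  unfold ups; rewrite filter_In, nd_test_true, in_map_iff. split.
  - intros [[x [<- Hx]] Hn]; eauto.
  - intros [Hn [x [-> Hx]]]; eauto.
Qed.

Lemma filter_map_length_le {X} (f : X -> X) p l : (length (filter p (map f l)) <= length l)%nat.
Proof. rewrite <- (length_map f l); apply filter_length_le. Qed.

Lemma filter_map_length_lt {X} (f : X -> X) p l x :
  In x l -> p (f x) = false -> (length (filter p (map f l)) < length l)%nat.
Proof.
  induction l as [|a l IH]; intros [] Hp; simpl.
  - subst a; rewrite Hp. pose proof (filter_map_length_le f p l); lia.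
  - specialize (IH H Hp). destruct (p (f a)); simpl; lia.
Qed.

(** Disjointness of interiors, expressed by a separating coordinate hyperplane: this is the plane
    along which the induction cuts. *)
Definition sep (n : nat) (p q : point * point) : Prop :=
  exists j, (j < n)%nat /\ (snd p j <= fst q j \/ snd q j <= fst p j).

Lemma ForallOrdPairs_filter_map {X} (Q : X -> Prop) (R : X -> X -> Prop) f p l :
  (forall x y, Q x -> Q y -> R x y -> R (f x) (f y)) ->
  Forall Q l -> ForallOrdPairs R l -> ForallOrdPairs R (filter p (map f l)).
Proof.
  intros Hf HQ H; induction H as [|a l Ha Hl IH]; simpl; [constructor|].
  inversion HQ as [|? ? Qa Ql]; subst.
  assert (Forall (R (f a)) (filter p (map f l))).
  { apply Forall_forall; intros y Hy; apply filter_In in Hy; destruct Hy as [Hy _].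
    apply in_map_iff in Hy; destruct Hy as [x [<- Hx]].
    rewrite Forall_forall in Ha, Ql; auto. }
  destruct (p (f a)); [constructor|]; auto.
Qed.

Lemma low_snd_le n i c ab j : box_ok n ab -> (j < n)%nat -> snd (low i c ab) j <= snd ab j.
Proof.
  intros H Hj; simpl; destruct (Nat.eq_dec j i) as [->|].
  - rewrite upd_eq; apply clamp_between; auto.
  - rewrite upd_neq by assumption; lra.
Qed.

Lemma up_fst_ge n i c ab j : box_ok n ab -> (j < n)%nat -> fst ab j <= fst (up i c ab) j.
Proof.
  intros H Hj; simpl; destruct (Nat.eq_dec j i) as [->|].
  - rewrite upd_eq; apply clamp_between; auto.
  - rewrite upd_neq by assumption; lra.
Qed.

Lemma lows_sep n i c bs : Forall (box_ok n) bs -> ForallOrdPairs (sep n) bs ->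
  ForallOrdPairs (sep n) (lows n i c bs).
Proof.
  apply ForallOrdPairs_filter_map; intros x y Hx Hy [j [Hj H]]; exists j; split; [exact Hj|].
  pose proof (low_snd_le n i c x j Hx Hj). pose proof (low_snd_le n i c y j Hy Hj).
  simpl in *; destruct H; [left|right]; lra.
Qed.

Lemma ups_sep n i c bs : Forall (box_ok n) bs -> ForallOrdPairs (sep n) bs ->
  ForallOrdPairs (sep n) (ups n i c bs).
Proof.
  apply ForallOrdPairs_filter_map; intros x y Hx Hy [j [Hj H]]; exists j; split; [exact Hj|].
  pose proof (up_fst_ge n i c x j Hx Hj). pose proof (up_fst_ge n i c y j Hy Hj).
  simpl in *; destruct H; [left|right]; lra.
Qed.

Lemma low_sub n i c ab x : (i < n)%nat -> box_ok n ab -> box_nd n (low i c ab) ->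
  in_box n (low i c ab) x -> in_box n ab x /\ x i <= c.
Proof.
  intros Hi Hok Hnd H; split.
  - intros j Hj; specialize (H j Hj). pose proof (low_snd_le n i c ab j Hok Hj).
    simpl in *; lra.
  - specialize (Hnd i Hi); specialize (H i Hi); simpl in *; rewrite upd_eq in *.
    unfold clamp, Rmax, Rmin in *.
    repeat destruct Rle_dec; lra.
Qed.

Lemma up_sub n i c ab x : (i < n)%nat -> box_ok n ab -> box_nd n (up i c ab) ->
  in_box n (up i c ab) x -> in_box n ab x /\ c <= x i.
Proof.
  intros Hi Hok Hnd H; split.
  - intros j Hj; specialize (H j Hj). pose proof (up_fst_ge n i c ab j Hok Hj).
    simpl in *; lra.
  - specialize (Hnd i Hi); specialize (H i Hi); specialize (Hok i Hi); simpl in *.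
    rewrite upd_eq in *. unfold clamp, Rmax, Rmin in *.
    repeat destruct Rle_dec; lra.
Qed.

Lemma clamp_lipschitz a b c c' : Rabs (clamp a b c - clamp a b c') <= Rabs (c - c').
Proof.
  unfold clamp, Rmax, Rmin, Rabs.
  repeat destruct Rle_dec; repeat destruct Rcase_abs; lra.
Qed.

Lemma clamp_continuity a b : continuity (clamp a b).
Proof.
  intros x e He; exists e; split; [exact He|]. intros y [_ Hy]; simpl in *.
  unfold R_dist in *. eapply Rle_lt_trans; [apply clamp_lipschitz|exact Hy].
Qed.

Lemma low_vol_continuity n i bs : (i < n)%nat ->
  continuity (fun c => lsum (fun ab => box_vol n (low i c ab)) bs).
Proof.
  intros Hi; induction bs as [|ab bs IH].
  - apply continuity_const; intros x y; reflexivity.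
  - destruct (split_vol_factor n i ab Hi) as [W HW].
    apply (continuity_plus (fun c => box_vol n (low i c ab)) _); [|exact IH].
    replace (fun c => box_vol n (low i c ab))
      with (fun c => (clamp (fst ab i) (snd ab i) c - fst ab i) * W).
    + apply (continuity_mult (fun c => clamp (fst ab i) (snd ab i) c - fst ab i) (fun _ => W)).
      * apply (continuity_minus (clamp (fst ab i) (snd ab i)) (fun _ => fst ab i)).
        -- apply clamp_continuity.
        -- apply continuity_const; intros x y; reflexivity.
      * apply continuity_const; intros x y; reflexivity.
    + apply functional_extensionality; intros c; now destruct (HW c) as [-> _].
Qed.

(** The volume below the plane x_i = c is continuous in c. It is 0 when the plane lies below all
    boxes and the full volume when it lies above them, so the intermediate value theorem applies. *)
Lemma cut_at_fraction n i bs t : (i < n)%nat -> Forall (box_ok n) bs ->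
  0 < t < boxes_vol n bs -> exists c, boxes_vol n (lows n i c bs) = t.
Proof.
  intros Hi Hok Ht.
  assert (HR : exists B, 0 < B /\ forall ab, In ab bs -> - B <= fst ab i /\ snd ab i <= B).
  { clear Hok Ht; induction bs as [|ab bs [B [HB IH]]].
    - exists 1; split; [lra|easy].
    - exists (Rmax B (Rmax (- fst ab i) (snd ab i))).
      pose proof (Rmax_l B (Rmax (- fst ab i) (snd ab i))).
      pose proof (Rmax_r B (Rmax (- fst ab i) (snd ab i))).
      pose proof (Rmax_l (- fst ab i) (snd ab i)). pose proof (Rmax_r (- fst ab i) (snd ab i)).
      split; [lra|]. intros cd [<-|Hcd]; [lra|]. specialize (IH cd Hcd); lra. }
  destruct HR as [B [HB HR]].
  set (g := fun c => lsum (fun ab => box_vol n (low i c ab)) bs).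
  assert (Hlo : g (- B) = 0).
  { unfold g; rewrite (lsum_ext _ (fun _ => 0)); [rewrite lsum_const; ring|].
    intros ab Hab; destruct (split_vol_factor n i ab Hi) as [W HW].
    destruct (HW (- B)) as [-> _]. destruct (HR ab Hab).
    rewrite Forall_forall in Hok; specialize (Hok ab Hab i Hi).
    replace (clamp (fst ab i) (snd ab i) (- B)) with (fst ab i); [ring|].
    unfold clamp, Rmax, Rmin; repeat destruct Rle_dec; lra. }
  assert (Hhi : g B = boxes_vol n bs).
  { unfold g; apply lsum_ext.
    intros ab Hab; destruct (split_vol_factor n i ab Hi) as [W HW].
    destruct (HW B) as [-> [_ ->]]. destruct (HR ab Hab).
    rewrite Forall_forall in Hok; specialize (Hok ab Hab i Hi). f_equal; f_equal.
    unfold clamp, Rmax, Rmin; repeat destruct Rle_dec; lra. }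
  destruct (IVT (fun c => g c - t) (- B) B) as [c [_ Hc]].
  - apply (continuity_minus g (fun _ => t)); [now apply low_vol_continuity|].
    apply continuity_const; intros x y; reflexivity.
  - lra.
  - lra.
  - lra.
  - exists c; rewrite lows_vol by assumption. unfold g in Hc; lra.
Qed.

Lemma nd_vol_pos n bs : bs <> nil -> Forall (box_nd n) bs -> 0 < boxes_vol n bs.
Proof.
  intros Hne H; destruct H as [|ab bs Hab H]; [easy|].
  unfold boxes_vol; rewrite lsum_cons. apply Rplus_lt_le_0_compat.
  - apply prodn_pos; intros i Hi; specialize (Hab i Hi); lra.
  - apply lsum_nonneg; intros cd Hcd; apply box_vol_nonneg, nd_ok.
    rewrite Forall_forall in H; auto.
Qed.

Definition sum_covered n As Bs cs : Prop :=
  forall a b u v, In a As -> In b Bs -> in_box n a u -> in_box n b v ->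
    Exists (fun c => in_box n c (padd u v)) cs.

(** Brunn-Minkowski without roots: [rho] is the ratio of the n-th roots of the two volumes. An
    arbitrary cover [cs] of the sums takes the place of the sumset, so only volumes of box lists
    occur; [s] is the induction measure. *)
Definition BM_boxes (n s : nat) : Prop := forall rho As Bs cs, 0 < rho ->
  (length As + length Bs <= s)%nat ->
  Forall (box_nd n) As -> Forall (box_nd n) Bs ->
  ForallOrdPairs (sep n) As -> ForallOrdPairs (sep n) Bs -> As <> nil ->
  boxes_vol n Bs = rho ^ n * boxes_vol n As ->
  Forall (box_ok n) cs -> sum_covered n As Bs cs ->
  (1 + rho) ^ n * boxes_vol n As <= boxes_vol n cs.

Lemma lows_nd n i c bs : Forall (box_nd n) (lows n i c bs).
Proof. apply Forall_forall; intros ab Hab; now apply in_lows in Hab. Qed.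

Lemma ups_nd n i c bs : Forall (box_nd n) (ups n i c bs).
Proof. apply Forall_forall; intros ab Hab; now apply in_ups in Hab. Qed.

(* Hadwiger-Ohmann: cut [As] by a hyperplane separating two of its boxes and [Bs]
   by a parallel hyperplane in the same volume ratio. *)
Lemma BM_boxes_step n s rho As Bs cs : BM_boxes n s -> 0 < rho ->
  (length As + length Bs <= S s)%nat -> (2 <= length As)%nat ->
  Forall (box_nd n) As -> Forall (box_nd n) Bs ->
  ForallOrdPairs (sep n) As -> ForallOrdPairs (sep n) Bs ->
  boxes_vol n Bs = rho ^ n * boxes_vol n As ->
  Forall (box_ok n) cs -> sum_covered n As Bs cs ->
  (1 + rho) ^ n * boxes_vol n As <= boxes_vol n cs.
Proof.
  intros IH Hr Hs H2 HA HB SA SB HV Hcs Hcov.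
  assert (Hcut : exists i c x y, (i < n)%nat /\ In x As /\ In y As /\
            snd x i <= c /\ c <= fst y i).
  { destruct As as [|x [|y As]]; simpl in H2; try lia.
    inversion SA as [|? ? Hx _]; subst. inversion Hx as [|? ? [j [Hj [H|H]]] _]; subst.
    - exists j, (snd x j), x, y; repeat split; auto; try lra; simpl; auto.
    - exists j, (snd y j), y, x; repeat split; auto; try lra; simpl; auto. }
  destruct Hcut as (i & c & x & y & Hi & Hx & Hy & Hxc & Hyc).
  assert (OA : Forall (box_ok n) As) by (eapply Forall_impl; [apply nd_ok|exact HA]).
  assert (OB : Forall (box_ok n) Bs) by (eapply Forall_impl; [apply nd_ok|exact HB]).
  assert (Nx : box_nd n x) by (rewrite Forall_forall in HA; auto).
  assert (Ny : box_nd n y) by (rewrite Forall_forall in HA; auto).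
  assert (NL : lows n i c As <> nil).
  { intros E. assert (Hin : In (low i c x) (lows n i c As)); [|rewrite E in Hin; easy].
    apply in_lows; split; [|eauto]. intros j Hj; simpl.
    destruct (Nat.eq_dec j i) as [->|]; [|rewrite upd_neq; auto].
    rewrite upd_eq; specialize (Nx i Hi).
    unfold clamp, Rmax, Rmin; repeat destruct Rle_dec; lra. }
  assert (NU : ups n i c As <> nil).
  { intros E. assert (Hin : In (up i c y) (ups n i c As)); [|rewrite E in Hin; easy].
    apply in_ups; split; [|eauto]. intros j Hj; simpl.
    destruct (Nat.eq_dec j i) as [->|]; [|rewrite upd_neq; auto].
    rewrite upd_eq; specialize (Ny i Hi).
    unfold clamp, Rmax, Rmin; repeat destruct Rle_dec; lra. }
  (* [y] lies above the plane, so its lower half is flat and gets discarded; [x] plays this part for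
     the upper halves. *)
  assert (LL : (length (lows n i c As) < length As)%nat).
  { apply filter_map_length_lt with y; [exact Hy|].
    apply Bool.not_true_is_false; rewrite nd_test_true; intros N.
    specialize (N i Hi); specialize (Ny i Hi); simpl in N; rewrite upd_eq in N.
    unfold clamp, Rmax, Rmin in N; repeat destruct Rle_dec; lra. }
  assert (LU : (length (ups n i c As) < length As)%nat).
  { apply filter_map_length_lt with x; [exact Hx|].
    apply Bool.not_true_is_false; rewrite nd_test_true; intros N.
    specialize (N i Hi); specialize (Nx i Hi); simpl in N; rewrite upd_eq in N.
    unfold clamp, Rmax, Rmin in N; repeat destruct Rle_dec; lra. }
  pose proof (nd_vol_pos n _ NL (lows_nd n i c As)) as PL.
  pose proof (nd_vol_pos n _ NU (ups_nd n i c As)) as PU.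
  pose proof (lows_ups_vol n i c As Hi OA) as EA.
  assert (Prn : 0 < rho ^ n) by now apply pow_lt.
  (* The plane for [Bs] is placed so that the lower parts have volume ratio [rho ^ n]. By
     subtraction so do the upper parts, and the induction hypothesis applies to both with the same
     [rho]. *)
  destruct (cut_at_fraction n i Bs (rho ^ n * boxes_vol n (lows n i c As)) Hi OB) as [d Hd].
  { split; [now apply Rmult_lt_0_compat|]. rewrite HV. apply Rmult_lt_compat_l; lra. }
  pose proof (lows_ups_vol n i d Bs Hi OB) as EB.
  (* A sum of points below x_i = c and x_i = d lies below x_i = c + d, so the lower halves of [cs]
     already cover these sums, and likewise above. The halves of [cs] add up to [cs] without
     loss. *)
  assert (H_low : (1 + rho) ^ n * boxes_vol n (lows n i c As)
            <= boxes_vol n (map (low i (c + d)) cs)).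
  { apply IH with (Bs := lows n i d Bs); auto using lows_nd, lows_sep.
    - pose proof (filter_map_length_le (low i d) (nd_test n) Bs). unfold lows at 2; lia.
    - apply Forall_map_ok; [|exact Hcs]; intros; now apply low_ok.
    - intros a b u v Ha Hb Hu Hv. apply in_lows in Ha, Hb.
      destruct Ha as [Na [a' [-> Ha]]], Hb as [Nb [b' [-> Hb]]].
      apply low_sub in Hu; [|exact Hi|rewrite Forall_forall in OA; auto|exact Na].
      apply low_sub in Hv; [|exact Hi|rewrite Forall_forall in OB; auto|exact Nb].
      destruct Hu as [Hu1 Hu2], Hv as [Hv1 Hv2].
      specialize (Hcov a' b' u v Ha Hb Hu1 Hv1).
      apply Exists_map; apply Exists_exists in Hcov; apply Exists_exists.
      destruct Hcov as [q [Hq1 Hq2]]; exists q; split; [exact Hq1|].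
      apply in_low; [exact Hq2|unfold padd; lra]. }
  assert (H_up : (1 + rho) ^ n * boxes_vol n (ups n i c As)
            <= boxes_vol n (map (up i (c + d)) cs)).
  { apply IH with (Bs := ups n i d Bs); auto using ups_nd, ups_sep.
    - pose proof (filter_map_length_le (up i d) (nd_test n) Bs). unfold ups at 2; lia.
    - replace (boxes_vol n (ups n i c As))
        with (boxes_vol n As - boxes_vol n (lows n i c As)) by lra.
      rewrite Rmult_minus_distr_l, <- HV, <- Hd; lra.
    - apply Forall_map_ok; [|exact Hcs]; intros; now apply up_ok.
    - intros a b u v Ha Hb Hu Hv. apply in_ups in Ha, Hb.
      destruct Ha as [Na [a' [-> Ha]]], Hb as [Nb [b' [-> Hb]]].
      apply up_sub in Hu; [|exact Hi|rewrite Forall_forall in OA; auto|exact Na].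
      apply up_sub in Hv; [|exact Hi|rewrite Forall_forall in OB; auto|exact Nb].
      destruct Hu as [Hu1 Hu2], Hv as [Hv1 Hv2].
      specialize (Hcov a' b' u v Ha Hb Hu1 Hv1).
      apply Exists_map; apply Exists_exists in Hcov; apply Exists_exists.
      destruct Hcov as [q [Hq1 Hq2]]; exists q; split; [exact Hq1|].
      apply in_up; [exact Hq2|unfold padd; lra]. }
  assert (EC : boxes_vol n (map (low i (c + d)) cs) + boxes_vol n (map (up i (c + d)) cs)
            = boxes_vol n cs).
  { unfold boxes_vol; rewrite !lsum_map, <- lsum_plus; apply lsum_ext; intros q _.
    now apply split_vol. }
  rewrite <- EA, Rmult_plus_distr_l; lra.
Qed.

(** Induction on the number of boxes: two single boxes are the AM-GM case, and otherwise a family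
    with at least two boxes is cut. *)
Lemma BM_boxes_all n s : (1 <= n)%nat -> BM_boxes n s.
Proof.
  intros Hn; induction s as [|s IH]; intros rho As Bs cs Hr Hs HA HB SA SB NA HV Hcs Hcov.
  - destruct As; simpl in Hs; [easy|lia].
  - pose proof (nd_vol_pos n As NA HA) as PA.
    assert (Prn : 0 < rho ^ n) by now apply pow_lt.
    destruct As as [|a [|a' As]]; [easy| |].
    + destruct Bs as [|b [|b' Bs]].
      * assert (0 < boxes_vol n nil) by (rewrite HV; now apply Rmult_lt_0_compat).
        unfold boxes_vol, lsum in H; simpl in H; lra.
      * inversion HA as [|? ? Na _]; subst. inversion HB as [|? ? Nb _]; subst.
        unfold boxes_vol in *; rewrite !lsum_cons in *.
        unfold lsum at 1 in HV; unfold lsum at 1 in HV; unfold lsum at 1; simpl in *.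
        rewrite !Rplus_0_r in *.
        apply Rle_trans with
          (prodn n (fun i => (snd a i - fst a i) + (snd b i - fst b i))).
        -- apply prodn_superadditive; auto; intros i Hi; [specialize (Na i Hi)|specialize (Nb i Hi)]; lra.
        -- set (ab := ((fun i => fst a i + fst b i), (fun i => snd a i + snd b i)) : point * point).
           apply Rle_trans with (box_vol n ab).
           { right; apply prodn_ext; intros i _; simpl; ring. }
           apply box_le_cover; [|exact Hcs|].
           { intros i Hi; simpl; specialize (Na i Hi); specialize (Nb i Hi); lra. }
           intros x Hx; change (in_box n ab x) in Hx.
           (* Every coordinate has its own splitting parameter; boxes are products, so the two
              pieces still lie in [a] and [b]. *)
           set (t := fun i => (x i - fst ab i) / (snd ab i - fst ab i)).
           specialize (Hcov a b (fun i => fst a i + t i * (snd a i - fst a i))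
             (fun i => fst b i + t i * (snd b i - fst b i))).
           assert (Ht : forall i, (i < n)%nat -> 0 <= t i <= 1 /\
              x i = fst ab i + t i * (snd ab i - fst ab i)).
           { intros i Hi; specialize (Na i Hi); specialize (Nb i Hi); specialize (Hx i Hi).
             simpl in Hx.
             assert (Hw : 0 < snd ab i - fst ab i) by (simpl; lra).
             unfold t; split; [split|].
             - apply Rmult_le_pos; [simpl; lra|now apply Rlt_le, Rinv_0_lt_compat].
             - apply Rmult_le_reg_r with (snd ab i - fst ab i); [exact Hw|].
               unfold Rdiv; rewrite Rmult_assoc, Rinv_l by lra. simpl in *; lra.
             - field; lra. }
           assert (Hex : Exists (fun c => in_box n c
              (padd (fun i => fst a i + t i * (snd a i - fst a i))
                    (fun i => fst b i + t i * (snd b i - fst b i)))) cs).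
           { apply Hcov; [now left|now left| |].
             - intros i Hi; destruct (Ht i Hi) as [[T0 T1] _]; specialize (Na i Hi); nra.
             - intros i Hi; destruct (Ht i Hi) as [[T0 T1] _]; specialize (Nb i Hi); nra. }
           eapply Exists_impl; [|exact Hex]. intros c Hc i Hi; specialize (Hc i Hi).
           unfold padd in Hc; destruct (Ht i Hi) as [_ Ex]. simpl in Ex.
           replace (x i) with
             (fst a i + t i * (snd a i - fst a i) + (fst b i + t i * (snd b i - fst b i)))
             by (rewrite Ex; ring). exact Hc.
      (* Only [Bs] can be cut here, so the families exchange roles and the ratio becomes [/ rho]. *)
      * assert (H : (1 + / rho) ^ n * boxes_vol n (b :: b' :: Bs) <= boxes_vol n cs).
        { apply BM_boxes_step with s (a :: nil); auto.
          - now apply Rinv_0_lt_compat.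
          - simpl in *; lia.
          - simpl; lia.
          - rewrite HV, pow_inv. field; lra.
          - intros p q u v Hp Hq Hu Hv.
            eapply Exists_impl; [|exact (Hcov q p v u Hq Hp Hv Hu)].
            intros c Hc j Hj; specialize (Hc j Hj); unfold padd in *; lra. }
        eapply Rle_trans; [|exact H]. rewrite HV, <- Rmult_assoc, <- Rpow_mult_distr.
        replace ((1 + / rho) * rho) with (1 + rho) by (field; lra). lra.
    + apply BM_boxes_step with s Bs; auto. simpl; lia.
Qed.

(** * From families of boxes to bounded sets *)

Lemma finite_enum {X : Type} (P : X -> Prop) (l : list X) : (forall z, P z -> In z l) ->
  exists l', NoDup l' /\ forall z, In z l' <-> P z.
Proof.
  intros H.
  exists (nodup (fun x y => excluded_middle_informative (x = y))
    (filter (fun z => if excluded_middle_informative (P z) then true else false) l)).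
  split; [apply NoDup_nodup|]. intros z; rewrite nodup_In, filter_In.
  destruct excluded_middle_informative; split; try easy. intros; split; auto.
Qed.

Lemma touching_cubes n K T : bounded n K -> 0 < T -> exists zs, NoDup zs /\
  forall z, In z zs <-> exists x, K x /\ z = floor_pt n T x.
Proof.
  intros [M HM] HT.
  apply finite_enum with (grid n (fun _ => - (T * M) - 1) (fun _ => T * M)).
  intros z [x [Hx ->]]; apply in_grid; split; [apply floor_pt_supported|].
  intros i Hi; pose proof (floor_pt_spec n T x i Hi). specialize (HM x Hx i Hi).
  apply Rabs_le_between in HM.
  assert (- (T * M) <= T * x i <= T * M); [|lra].
  split; [replace (- (T * M)) with (T * - M) by ring|]; apply Rmult_le_compat_l; lra.
Qed.

Lemma cubes_sep n T zs : 0 < T -> NoDup zs -> (forall z, In z zs -> supported n z) ->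
  ForallOrdPairs (sep n) (map (cube T) zs).
Proof.
  intros HT H Hs; induction H as [|z zs Hz H IH]; simpl; [constructor|].
  constructor; [|apply IH; intros; apply Hs; now right].
  apply Forall_map, Forall_forall; intros w Hw.
  assert (Hex : exists j, (j < n)%nat /\ z j <> w j).
  { apply NNPP; intros Hn; apply Hz. replace z with w; [exact Hw|].
    apply functional_extensionality; intros j.
    destruct (le_lt_dec n j) as [Hj|Hj].
    - rewrite (Hs z), (Hs w); auto; simpl; auto.
    - apply NNPP; intros Hne; apply Hn; exists j; auto. }
  destruct Hex as [j [Hj Hne]]; exists j; split; [exact Hj|]; simpl.
  assert (HTi : 0 <= / T) by now apply Rlt_le, Rinv_0_lt_compat.
  assert (z j + 1 <= w j \/ w j + 1 <= z j)%Z as [Hl|Hl] by lia;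
    [left|right]; apply Rmult_le_compat_r; try exact HTi;
    rewrite <- plus_IZR; now apply IZR_le.
Qed.

Lemma msum_bounded n K L : bounded n K -> bounded n L -> bounded n (msum K L).
Proof.
  intros [M HM] [M' HM']; exists (M + M'); intros x [y [z [Hy [Hz ->]]]] i Hi.
  unfold padd; eapply Rle_trans; [apply Rabs_triang|].
  apply Rplus_le_compat; auto.
Qed.

Lemma boxes_vol_enlarge_lim n bs e :
  is_lim_seq (fun k => lsum (fun ab => prodn n (fun i => snd ab i - fst ab i + e / INR (S k))) bs)
    (boxes_vol n bs).
Proof. apply lim_lsum; intros ab _; apply lim_prodn; intros i _; apply lim_affine_div. Qed.

Lemma pow_le_inv n p q : (1 <= n)%nat -> 0 <= p -> 0 <= q -> p ^ n <= q ^ n -> p <= q.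
Proof.
  intros Hn Hp Hq H; apply Rnot_lt_le; intros Hlt.
  assert (Hlt' : q ^ n < p ^ n); [|lra]. clear H.
  destruct n as [|n]; [lia|]. clear Hn.
  induction n as [|n IH]; [simpl; lra|].
  rewrite <- !(tech_pow_Rmult _ (S n)).
  apply Rle_lt_trans with (q * p ^ S n).
  - apply Rmult_le_compat_l; lra.
  - apply Rmult_lt_compat_r; [apply pow_lt; lra|exact Hlt].
Qed.

(** Any cover [cs] of the sum, slightly enlarged, covers all sums of mesh cubes touching [K] and
    [L]. Those cubes have at least the volumes of [K] and [L], and positive volume even when the
    sets themselves have none, so the inequality for boxes applies. Then the mesh is refined with
    [cs] fixed. *)
Theorem brunn_minkowski n K L a b : (1 <= n)%nat ->
  (exists x, K x) -> (exists x, L x) -> bounded n K -> bounded n L ->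
  0 <= a -> 0 <= b -> a ^ n = volume n K -> b ^ n = volume n L ->
  (a + b) ^ n <= volume n (msum K L).
Proof.
  intros Hn [x0 Hx0] [y0 Hy0] BK BL Ha Hb EK EL.
  apply le_volume; [now apply msum_bounded|]; intros cs Hcs Hcov.
  apply lim_le_const with
    (fun k => lsum (fun ab => prodn n (fun i => snd ab i - fst ab i + 4 / INR (S k))) cs);
    [apply boxes_vol_enlarge_lim|].
  intros k; set (T := INR (S k)). assert (HT : 0 < T) by (apply lt_0_INR; lia).
  assert (HTi : 0 < / T) by now apply Rinv_0_lt_compat.
  destruct (touching_cubes n K T BK HT) as [zs [Nz Hz]].
  destruct (touching_cubes n L T BL HT) as [ws [Nw Hw]].
  assert (Sz : forall z, In z zs -> supported n z)
    by (intros z Hz'; apply Hz in Hz'; destruct Hz' as [x [_ ->]]; apply floor_pt_supported).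
  assert (Sw : forall z, In z ws -> supported n z)
    by (intros z Hz'; apply Hw in Hz'; destruct Hz' as [x [_ ->]]; apply floor_pt_supported).
  assert (ND : forall l, Forall (box_nd n) (map (cube T) l)).
  { intros l; apply Forall_map, Forall_forall; intros z _ i Hi; now apply cube_lt with n. }
  assert (NZ : map (cube T) zs <> nil).
  { assert (Hin : In (floor_pt n T x0) zs) by (apply Hz; eauto). destruct zs; [easy|discriminate]. }
  assert (NW : map (cube T) ws <> nil).
  { assert (Hin : In (floor_pt n T y0) ws) by (apply Hw; eauto). destruct ws; [easy|discriminate]. }
  pose proof (nd_vol_pos n _ NZ (ND zs)) as PZ. pose proof (nd_vol_pos n _ NW (ND ws)) as PW.
  assert (VZ : a ^ n <= boxes_vol n (map (cube T) zs)).
  { rewrite EK; apply volume_le_cover; [exact BK|now apply cubes_ok|].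
    intros x Hx; apply Exists_exists; exists (cube T (floor_pt n T x)).
    split; [apply in_map, Hz; eauto|now apply floor_pt_cube]. }
  assert (VW : b ^ n <= boxes_vol n (map (cube T) ws)).
  { rewrite EL; apply volume_le_cover; [exact BL|now apply cubes_ok|].
    intros x Hx; apply Exists_exists; exists (cube T (floor_pt n T x)).
    split; [apply in_map, Hw; eauto|now apply floor_pt_cube]. }
  destruct (nth_root_exists n _ Hn (Rlt_le _ _ PZ)) as [a' [Ha' Ea]].
  destruct (nth_root_exists n _ Hn (Rlt_le _ _ PW)) as [b' [Hb' Eb]].
  assert (Ha0 : 0 < a') by (destruct Ha' as [|<-]; [lra|rewrite pow_ne_zero in Ea by lia; lra]).
  assert (Hb0 : 0 < b') by (destruct Hb' as [|<-]; [lra|rewrite pow_ne_zero in Eb by lia; lra]).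
  assert (La : a <= a') by (apply (pow_le_inv n); auto; lra).
  assert (Lb : b <= b') by (apply (pow_le_inv n); auto; lra).
  apply Rle_trans with ((a' + b') ^ n); [apply pow_incr; lra|].
  (* In each coordinate a point of a touching cube is within 1/T of a point of the body, so a sum of
     two is within 2/T of [msum K L]. Widening by [e] at both ends gives the 4/T of the limit. *)
  set (e := 2 / T).
  set (f := fun c : point * point => ((fun i => fst c i - e), (fun i => snd c i + e)) : point * point).
  assert (He : 0 < e) by (apply Rmult_lt_0_compat; lra).
  apply Rle_trans with (boxes_vol n (map f cs)).
  - replace ((a' + b') ^ n) with ((1 + b' / a') ^ n * boxes_vol n (map (cube T) zs)).
    + apply BM_boxes_all with (s := (length (map (cube T) zs) + length (map (cube T) ws))%nat)
        (Bs := map (cube T) ws); auto using cubes_sep.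
      * now apply Rdiv_lt_0_compat.
      * rewrite <- Eb, <- Ea, <- Rpow_mult_distr; f_equal; field; lra.
      * apply Forall_map_ok; [|exact Hcs]. intros c Hc i Hi; specialize (Hc i Hi); simpl; lra.
      * intros p q u v Hp Hq Hu Hv.
        apply in_map_iff in Hp, Hq; destruct Hp as [z [<- Hp]], Hq as [w [<- Hq]].
        apply Hz in Hp; apply Hw in Hq.
        destruct Hp as [x [Hx ->]], Hq as [y [Hy ->]].
        assert (Hc : msum K L (padd x y)) by (exists x, y; auto).
        apply Hcov in Hc; apply Exists_map. eapply Exists_impl; [|exact Hc].
        intros c Hc' i Hi; specialize (Hc' i Hi); specialize (Hu i Hi); specialize (Hv i Hi).
        pose proof (floor_pt_cube n T x HT i Hi) as Hxx.
        pose proof (floor_pt_cube n T y HT i Hi) as Hyy.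
        simpl in *; unfold padd in *. unfold e, Rdiv in *. lra.
    + rewrite <- Ea, <- Rpow_mult_distr; f_equal; field; lra.
  - right; unfold boxes_vol; rewrite lsum_map; apply lsum_ext; intros c _.
    apply prodn_ext; intros i _. change (INR (S k)) with T.
    replace (4 / T) with (2 * e) by (unfold e; field; lra). unfold f, point; simpl; ring.
Qed.

(** * Sumset cardinalities *)

(** The labels of the three bodies, [T1] and [T2] for K1 and K2 and [T3] for A; a function
    [tri -> nat] records how many summands of each are taken. *)
Inductive tri : Type := T1 | T2 | T3.

Definition tri_eqb (i j : tri) : bool :=
  match i, j with T1, T1 | T2, T2 | T3, T3 => true | _, _ => false end.

Definition inc (t : tri) (N : tri -> nat) : tri -> nat :=
  fun i => if tri_eqb t i then S (N i) else N i.

Definition dec (t : tri) (k : nat) (N : tri -> nat) : tri -> nat :=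
  fun i => if tri_eqb t i then (N i - k)%nat else N i.

Definition raise (t : tri) (k : nat) (N : tri -> nat) : tri -> nat :=
  fun i => if tri_eqb t i then (N i + k)%nat else N i.

Fixpoint nsum (f : nat -> nat) (m : nat) : nat :=
  match m with O => f O | S m => (nsum f m + f (S m))%nat end.

Lemma nsum_ext f g m : (forall k, (k <= m)%nat -> f k = g k) -> nsum f m = nsum g m.
Proof.
  induction m as [|m IH]; intros H; simpl; [apply H; lia|].
  rewrite IH, H; auto; lia.
Qed.

Lemma nsum_shift f m : nsum f (S m) = (f O + nsum (fun j => f (S j)) m)%nat.
Proof. induction m as [|m IH]; [reflexivity|]. simpl in *; rewrite IH; lia. Qed.

Lemma nsum_rev f m : nsum (fun j => f (m - j)%nat) m = nsum f m.
Proof.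
  revert f; induction m as [|m IH]; intros f; [reflexivity|].
  rewrite nsum_shift; simpl. rewrite (IH f), Nat.add_comm; reflexivity.
Qed.

Lemma nsum_plus f g m : nsum (fun k => f k + g k)%nat m = (nsum f m + nsum g m)%nat.
Proof. induction m as [|m IH]; simpl; lia. Qed.

Lemma nsum_mul f c m : nsum (fun k => f k * c)%nat m = (nsum f m * c)%nat.
Proof. induction m as [|m IH]; simpl; [reflexivity|]. rewrite IH; lia. Qed.

(** The cut at [K] mirrors a lower set whose slices are constant from [K] on: earlier slices are
    listed singly, the later ones are summed together. *)
Lemma nsum_split F K m : nsum F m =
  (list_sum (map (fun k => if k <=? m then F k else 0)%nat (seq 0 K))
   + (if K <=? m then nsum (fun j => F (K + j)) (m - K) else 0))%nat.
Proof.
  induction K as [|K IH].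
  - simpl; now rewrite Nat.sub_0_r.
  - rewrite IH, seq_S, map_app, list_sum_app; simpl.
    destruct (Nat.leb_spec K m) as [H|H].
    + destruct m as [|m].
      * assert (K = 0)%nat by lia; subst K; simpl; lia.
      * destruct (Nat.leb_spec K m) as [H'|H'].
        -- replace (S m - K)%nat with (S (m - K)) by lia.
           rewrite nsum_shift; cbv beta; rewrite !Nat.add_0_r.
           replace (nsum (fun j => F (K + S j)%nat) (m - K))
             with (nsum (fun j => F (S (K + j))) (m - K)).
           { rewrite Nat.sub_succ; lia. }
           apply nsum_ext; intros; f_equal; lia.
        -- replace (S m - K)%nat with O by lia. simpl. rewrite Nat.add_0_r. lia.
    + destruct m as [|m]; [lia|]. destruct (Nat.leb_spec K m); lia.
Qed.

(* [bin d m] is the number of vectors in N^d with coordinate sum [m]. *)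
Fixpoint bin (d : nat) : nat -> nat :=
  match d with
  | O => fun m => if m =? 0 then 1%nat else 0%nat
  | S d => nsum (bin d)
  end.

(** The test [m <? a] prevents the truncated subtraction from counting vectors below the apex. *)
Definition shifted_bin (a d m : nat) : nat := if m <? a then 0%nat else bin d (m - a).

Lemma shifted_bin_raise a d k m :
  shifted_bin (a + k) d m = if (k <=? m)%nat then shifted_bin a d (m - k) else 0%nat.
Proof.
  unfold shifted_bin.
  destruct (Nat.leb_spec k m); destruct (Nat.ltb_spec m (a + k));
    destruct (Nat.ltb_spec (m - k) a); try lia.
  f_equal; lia.
Qed.

Lemma shifted_bin_S a d m : shifted_bin a (S d) m = nsum (shifted_bin a d) m.
Proof.
  induction m as [|m IH].
  - unfold shifted_bin; simpl. destruct (Nat.ltb_spec 0 a); [reflexivity|].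
    now replace a with O by lia.
  - simpl nsum; rewrite <- IH. unfold shifted_bin.
    destruct (Nat.ltb_spec (S m) a); destruct (Nat.ltb_spec m a); try lia.
    + replace (S m - a)%nat with O by lia; reflexivity.
    + replace (S m - a)%nat with (S (m - a)) by lia; reflexivity.
Qed.

(* A cell [(a, d)] stands for a translated coordinate orthant: [a] collects the apex and [d]
   the number of free directions, both sorted by type. *)
Definition cell : Type := (tri -> nat) * (tri -> nat).

Definition cell_count (c : cell) (N : tri -> nat) : nat :=
  (shifted_bin (fst c T1) (snd c T1) (N T1) * shifted_bin (fst c T2) (snd c T2) (N T2)
   * shifted_bin (fst c T3) (snd c T3) (N T3))%nat.

Definition cell_sum (cs : list cell) (N : tri -> nat) : nat :=
  list_sum (map (fun c => cell_count c N) cs).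

Lemma cell_sum_app cs cs' N : cell_sum (cs ++ cs') N = (cell_sum cs N + cell_sum cs' N)%nat.
Proof. unfold cell_sum; now rewrite map_app, list_sum_app. Qed.

(** Two ways to prefix a coordinate of type [t]: [cell_raise] freezes it at [k], and [cell_extend]
    lets it take every value from [k] on. *)
Definition cell_raise (t : tri) (k : nat) (c : cell) : cell := (raise t k (fst c), snd c).
Definition cell_extend (t : tri) (k : nat) (c : cell) : cell :=
  (raise t k (fst c), inc t (snd c)).

Lemma cell_raise_count t k c N :
  cell_count (cell_raise t k c) N =
  if (k <=? N t)%nat then cell_count c (dec t k N) else 0%nat.
Proof.
  destruct c as [a d]; unfold cell_count, cell_raise, raise, dec.
  destruct t; simpl; rewrite shifted_bin_raise; destruct (k <=? _)%nat; lia.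
Qed.

Lemma cell_extend_count t k c N :
  cell_count (cell_extend t k c) N =
  if (k <=? N t)%nat
  then nsum (fun j => cell_count c (dec t (k + j) N)) (N t - k) else 0%nat.
Proof.
  assert (E : forall a d m, (k <= m)%nat ->
    shifted_bin a (S d) (m - k) = nsum (fun j => shifted_bin a d (m - (k + j))) (m - k)).
  { intros a d m Hk. rewrite shifted_bin_S, <- nsum_rev.
    apply nsum_ext; intros; f_equal; lia. }
  destruct c as [a d]; unfold cell_count, cell_extend, raise, inc, dec.
  destruct t; cbn [tri_eqb fst snd]; rewrite shifted_bin_raise;
    match goal with |- context [(k <=? ?x)%nat] => destruct (Nat.leb_spec k x) end;
    rewrite ?Nat.mul_0_r; try reflexivity; rewrite E by assumption.
  - now rewrite <- !nsum_mul.
  - rewrite (Nat.mul_comm (shifted_bin (a T1) (d T1) (N T1))), <- !nsum_mul.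
    apply nsum_ext; intros; ring.
  - rewrite Nat.mul_comm, <- nsum_mul. apply nsum_ext; intros; ring.
Qed.

(** * Lower sets of vectors as finite disjoint unions of cells *)

Fixpoint cnt (ts : list tri) (l : list nat) : tri -> nat :=
  match ts, l with
  | t :: ts, k :: l => fun i => ((if tri_eqb t i then k else 0) + cnt ts l i)%nat
  | _, _ => fun _ => 0%nat
  end.

Definition lower (D : list nat -> Prop) : Prop :=
  forall l m, Forall2 le m l -> D l -> D m.

Lemma Forall2_le_refl l : Forall2 le l l.
Proof. induction l; constructor; auto. Qed.

Lemma decreasing_le (D : nat -> list nat -> Prop) :
  (forall k l, D (S k) l -> D k l) -> forall k k' l, (k <= k')%nat -> D k' l -> D k l.
Proof. intros H k k' l Hk; induction Hk; auto. Qed.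

(* Dickson's lemma, for chains of lower sets. *)
Lemma lower_chain_stabilises h (D : nat -> list nat -> Prop) :
  (forall k, lower (D k)) -> (forall k l, D (S k) l -> D k l) ->
  exists K, forall k l, (K <= k)%nat -> length l = h -> D K l -> D k l.
Proof.
  revert D; induction h as [|h IH]; intros D HL HD.
  - destruct (classic (forall k, D k nil)) as [H|H].
    + exists O; intros k l _ Hl _; destruct l; [apply H|discriminate].
    + apply not_all_ex_not in H; destruct H as [K HK]; exists K.
      intros k l _ Hl HKl; destruct l; [easy|discriminate].
  - destruct (IH (fun j l => D j (j :: l))) as [J HJ].
    { intros j l m Hlm; apply HL; constructor; auto. }
    { intros j l Hl; apply HD in Hl. apply (HL j (S j :: l)); [|exact Hl].
      constructor; [lia|apply Forall2_le_refl]. }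
    assert (HK : forall J', exists K, forall t k l, (t < J')%nat -> (K <= k)%nat ->
      length l = h -> D K (t :: l) -> D k (t :: l)).
    { intros J'; induction J' as [|J' [K HK]].
      - exists O; intros; lia.
      - destruct (IH (fun k l => D k (J' :: l))) as [K' HK'].
        + intros k l m Hlm; apply HL; constructor; auto.
        + intros k l; apply HD.
        + exists (Nat.max K K'); intros t k l Ht Hk Hl HKl.
          destruct (Nat.eq_dec t J') as [->|Hne].
          * apply HK'; [lia|exact Hl|].
            apply (decreasing_le D HD) with (Nat.max K K'); [lia|exact HKl].
          * apply HK; [lia|lia|exact Hl|].
            apply (decreasing_le D HD) with (Nat.max K K'); [lia|exact HKl]. }
    destruct (HK J) as [K HK']; exists (Nat.max J K); intros k l Hk Hl HKl.
    destruct l as [|t l]; [discriminate|]. injection Hl as Hl.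
    destruct (lt_dec t J) as [Ht|Ht].
    + apply HK'; [exact Ht|lia|exact Hl|].
      apply (decreasing_le D HD) with (Nat.max J K); [lia|exact HKl].
    + assert (HJJ : D J (J :: l)).
      { apply (HL J (t :: l)); [constructor; [lia|apply Forall2_le_refl]|].
        apply (decreasing_le D HD) with (Nat.max J K); [lia|exact HKl]. }
      (* Stability of the diagonal moves membership up to index and head [Nat.max k t]; lowering the
         head to [t] and the index to [k] stays inside. *)
      apply (HJ (Nat.max k t)) in HJJ; [|lia|exact Hl].
      apply (HL k (Nat.max k t :: l)); [constructor; [lia|apply Forall2_le_refl]|].
      apply (decreasing_le D HD) with (Nat.max k t); [lia|exact HJJ].
Qed.

(** [D] may be infinite, but its vectors with prescribed sums over each type are finitely many. One
    list of cells has to count them for every [N], small [N] included. *)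
Definition counted_by (ts : list tri) (D : list nat -> Prop) (cs : list cell) : Prop :=
  forall N, exists ls, NoDup ls /\
    (forall l, In l ls <-> length l = length ts /\ D l /\ forall i, cnt ts l i = N i) /\
    length ls = cell_sum cs N.

(** The set is sliced by its first coordinate. Each slice below [K] is counted by itself; the slices
    from [K] on coincide and form the product of one slice with a half-line. *)
Lemma counted_by_cells_cons t ts (D : list nat -> Prop) (cs : nat -> list cell) K :
  (forall k l, (K <= k)%nat -> length l = length ts -> D (k :: l) <-> D (K :: l)) ->
  (forall k, counted_by ts (fun l => D (k :: l)) (cs k)) ->
  counted_by (t :: ts) D
    (flat_map (fun k => map (cell_raise t k) (cs k)) (seq 0 K)
     ++ map (cell_extend t K) (cs K)).
Proof.
  intros HK Hcs N.
  assert (Hcs' : forall k, counted_by ts (fun l => D (k :: l)) (cs (Nat.min k K))).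
  { intros k M; destruct (Hcs (Nat.min k K) M) as [ls [H1 [H2 H3]]].
    exists ls; split; [exact H1|split; [|exact H3]]. intros l; rewrite H2.
    destruct (le_lt_dec K k) as [Hk|Hk].
    - rewrite Nat.min_r by lia. split; intros [A [B C]]; repeat split; auto;
        apply (HK k l Hk A); exact B.
    - now rewrite Nat.min_l by lia. }
  (* [L k] lists the tails following the head [k], which uses up [k] of the multiplicity of type
     [t]. *)
  destruct (choice (fun k ls => NoDup ls /\
    (forall l, In l ls <-> length l = length ts /\ D (k :: l) /\ forall i, cnt ts l i = dec t k N i) /\
    length ls = cell_sum (cs (Nat.min k K)) (dec t k N))) as [L HL].
  { intros k; apply (Hcs' k (dec t k N)). }
  exists (flat_map (fun k => map (cons k) (L k)) (seq 0 (S (N t)))).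
  split; [|split].
  - assert (G : forall s, NoDup s -> NoDup (flat_map (fun k => map (cons k) (L k)) s));
      [|apply G, seq_NoDup].
    intros s Hs; induction Hs as [|k s Hk Hs IH]; simpl; [constructor|].
    apply NoDup_app; [|exact IH|].
    + apply FinFun.Injective_map_NoDup; [intros x y E; congruence|apply HL].
    + intros x Hx Hx'. apply in_map_iff in Hx; destruct Hx as [y [<- _]].
      apply in_flat_map in Hx'; destruct Hx' as [k' [Hk' Hx']].
      apply in_map_iff in Hx'; destruct Hx' as [y' [E _]]. congruence.
  - intros l; rewrite in_flat_map; split.
    + intros [k [Hk Hl]]; apply in_seq in Hk. apply in_map_iff in Hl.
      destruct Hl as [l' [<- Hl']]. apply HL in Hl'. destruct Hl' as [A [B C]].
      split; [simpl; congruence|split; [exact B|]].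
      intros i; simpl; rewrite C; unfold dec.
      destruct t, i; simpl in *; lia.
    + intros [A [B C]]; destruct l as [|k l]; [discriminate|].
      injection A as A. simpl in C.
      exists k; split.
      * apply in_seq; specialize (C t). destruct t; simpl in *; lia.
      * apply in_map, HL; split; [exact A|split; [exact B|]].
        intros i; specialize (C i); unfold dec. destruct t, i; simpl in *; lia.
  - rewrite cell_sum_app.
    assert (E1 : length (flat_map (fun k => map (cons k) (L k)) (seq 0 (S (N t))))
       = nsum (fun k => cell_sum (cs (Nat.min k K)) (dec t k N)) (N t)).
    { generalize (N t); intros m; induction m as [|m IH].
      - simpl; rewrite app_nil_r, length_map. apply HL.
      - rewrite seq_S, flat_map_app, length_app, IH; simpl.
        rewrite app_nil_r, length_map. f_equal; apply HL. }
    rewrite E1, (nsum_split _ K). f_equal.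
    + assert (G : forall s, (forall k, In k s -> (k < K)%nat) ->
        list_sum (map (fun k => if (k <=? N t)%nat
           then cell_sum (cs (Nat.min k K)) (dec t k N) else 0%nat) s)
        = cell_sum (flat_map (fun k => map (cell_raise t k) (cs k)) s) N).
      { intros s Hs; induction s as [|k s IH]; [reflexivity|].
        simpl flat_map; rewrite cell_sum_app, <- IH by (intros; apply Hs; now right).
        simpl; f_equal. specialize (Hs k (or_introl eq_refl)). rewrite Nat.min_l by lia.
        unfold cell_sum; rewrite map_map.
        induction (cs k) as [|c cs' IHc]; simpl; [now destruct (_ <=? _)%nat|].
        rewrite cell_raise_count, <- IHc. now destruct (_ <=? _)%nat. }
      apply G; intros k Hk; apply in_seq in Hk; lia.
    + unfold cell_sum; rewrite map_map.
      rewrite (map_ext_in _ (fun c => if (K <=? N t)%nat then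
        nsum (fun j => cell_count c (dec t (K + j) N)) (N t - K) else 0%nat))
        by (intros; apply cell_extend_count).
      destruct (Nat.leb_spec K (N t)) as [H|H].
      * rewrite (nsum_ext _ (fun j => list_sum (map (fun c => cell_count c (dec t (K + j) N)) (cs K))))
          by (intros; rewrite Nat.min_r by lia; reflexivity).
        induction (cs K) as [|c cs' IHc]; simpl.
        -- clear; induction (N t - K)%nat; simpl; lia.
        -- rewrite nsum_plus, IHc; reflexivity.
      * induction (cs K) as [|c cs' IHc]; simpl; auto.
Qed.

(** Induction on the dimension. The slices of a lower set by its first coordinate form a decreasing
    chain of lower sets, constant from some point on by Dickson's lemma. *)
Lemma lower_set_counted ts D : lower D -> exists cs, counted_by ts D cs.
Proof.
  revert D; induction ts as [|t ts IH]; intros D HD.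
  - destruct (classic (D nil)) as [H|H].
    (* The cell without free directions counts 1 for zero multiplicities and 0 otherwise, as does
       the empty vector. *)
    + exists (((fun _ => O), (fun _ => O)) :: nil); intros N.
      destruct (classic (forall i, N i = O)) as [HN|HN].
      * exists (nil :: nil); repeat split.
        -- repeat constructor; easy.
        -- destruct H0 as [<-|[]]; reflexivity.
        -- destruct H0 as [<-|[]]; exact H.
        -- destruct H0 as [<-|[]]; intros i; rewrite HN; reflexivity.
        -- intros [A _]; destruct l; [now left|discriminate].
        -- unfold cell_sum, cell_count, shifted_bin; simpl; now rewrite !HN.
      * exists nil; repeat split.
        -- constructor.
        -- easy.
        -- easy.
        -- easy.
        -- intros [_ [_ C]]; exfalso; apply HN; intros i; specialize (C i).
           destruct l; simpl in C; auto.
        -- unfold cell_sum, cell_count, shifted_bin; simpl. rewrite !Nat.sub_0_r.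
           destruct (Nat.eqb_spec (N T1) 0); destruct (Nat.eqb_spec (N T2) 0);
             destruct (Nat.eqb_spec (N T3) 0); try reflexivity.
           exfalso; apply HN; intros []; assumption.
    + exists nil; intros N; exists nil; split; [constructor|split; [|reflexivity]].
      intros l; split; [easy|]. intros [A [B _]]; destruct l; [easy|discriminate].
  - assert (HDk : forall k, lower (fun l => D (k :: l)))
      by (intros k l m Hlm; apply HD; constructor; auto).
    assert (Hdec : forall k l, D (S k :: l) -> D (k :: l)).
    { intros k l; apply HD; constructor; [lia|apply Forall2_le_refl]. }
    destruct (lower_chain_stabilises (length ts) (fun k l => D (k :: l)) HDk Hdec) as [K HK].
    destruct (choice (fun k cs => counted_by ts (fun l => D (k :: l)) cs)) as [cs Hcs].
    { intros k; apply IH, HDk. }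
    eexists; apply (counted_by_cells_cons t ts D cs K); [|exact Hcs].
    intros k l Hk Hl; split; [|now apply HK].
    apply (decreasing_le (fun k l => D (k :: l)) Hdec); exact Hk.
Qed.

(** * Sumsets and their lexicographically least representations *)

Fixpoint lexlt (l m : list nat) : Prop :=
  match l, m with
  | a :: l, b :: m => (a < b)%nat \/ (a = b /\ lexlt l m)
  | _, _ => False
  end.

Lemma lexlt_total l m : length l = length m -> lexlt l m \/ l = m \/ lexlt m l.
Proof.
  revert m; induction l as [|a l IH]; intros [|b m] H; try discriminate; [auto|].
  injection H as H; simpl. destruct (lt_eq_lt_dec a b) as [[|]|]; auto.
  destruct (IH m H) as [|[|]]; subst; auto.
Qed.

Lemma lex_min_exists h (P : list nat -> Prop) : (exists l, length l = h /\ P l) ->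
  exists l, length l = h /\ P l /\ forall m, length m = h -> P m -> ~ lexlt m l.
Proof.
  revert P; induction h as [|h IH]; intros P [l [Hl Pl]].
  - destruct l; [|discriminate]. exists nil; repeat split; auto.
    intros [|] _ _; simpl; auto.
  - destruct l as [|a l]; [discriminate|]. injection Hl as Hl.
    assert (Ha : exists l, length l = h /\ P (a :: l)) by eauto. clear l Hl Pl.
    induction a as [a IHa] using lt_wf_ind.
    destruct (classic (exists b, (b < a)%nat /\ exists l, length l = h /\ P (b :: l)))
      as [[b [Hb H]]|Hn]; [eauto|].
    destruct (IH (fun l => P (a :: l)) Ha) as [l [Hl [Pl Hmin]]].
    exists (a :: l); split; [simpl; congruence|split; [exact Pl|]].
    intros [|b m] Hm Pm; [discriminate|]. injection Hm as Hm. simpl.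
    intros [Hlt|[-> Hlt]]; [apply Hn; eauto|]. now apply (Hmin m).
Qed.

Fixpoint ladd (l m : list nat) : list nat :=
  match l, m with a :: l, b :: m => (a + b)%nat :: ladd l m | _, _ => nil end.

Lemma ladd_lexlt l m q : length l = length q -> length m = length q ->
  lexlt l m -> lexlt (ladd l q) (ladd m q).
Proof.
  revert m q; induction l as [|a l IH]; intros [|b m] [|c q] H1 H2; simpl; try easy.
  injection H1 as H1; injection H2 as H2.
  intros [H|[-> H]]; [left; lia|right; auto].
Qed.

Lemma ladd_length l m : length l = length m -> length (ladd l m) = length m.
Proof.
  revert m; induction l as [|a l IH]; intros [|b m] H; try discriminate; simpl; auto.
Qed.

Lemma Forall2_le_ladd m l : Forall2 le m l -> exists q, length q = length m /\ l = ladd m q.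
Proof.
  intros H; induction H as [|a b m l Hab H [q [Hq ->]]].
  - exists nil; auto.
  - exists ((b - a)%nat :: q); simpl; split; [congruence|f_equal; lia].
Qed.

Lemma cnt_ladd ts l m i : length l = length m ->
  cnt ts (ladd l m) i = (cnt ts l i + cnt ts m i)%nat.
Proof.
  revert l m; induction ts as [|t ts IH]; intros [|a l] [|b m] H; try discriminate;
    try reflexivity.
  simpl; injection H as H; rewrite IH by assumption; destruct (tri_eqb t i); lia.
Qed.

Fixpoint lin (gens : list (tri * ipoint)) (l : list nat) : ipoint :=
  match gens, l with
  | (_, v) :: gens, k :: l => fun i => (Z.of_nat k * v i + lin gens l i)%Z
  | _, _ => fun _ => 0%Z
  end.

Lemma lin_ladd g l m i : length l = length m ->
  lin g (ladd l m) i = (lin g l i + lin g m i)%Z.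
Proof.
  revert l m; induction g as [|[t v] g IH]; intros [|a l] [|b m] H; try discriminate;
    try reflexivity.
  simpl; injection H as H; rewrite IH by assumption; lia.
Qed.

(* [z] is a sum of elements of [gens], with exactly [N t] summands of type [t]. *)
Definition reach (gens : list (tri * ipoint)) (N : tri -> nat) (z : ipoint) : Prop :=
  exists l, length l = length gens /\ (forall i, cnt (map fst gens) l i = N i) /\ z = lin gens l.

Definition lex_least (gens : list (tri * ipoint)) (l : list nat) : Prop :=
  forall m, length m = length l -> lin gens m = lin gens l ->
    (forall i, cnt (map fst gens) m i = cnt (map fst gens) l i) -> ~ lexlt m l.

(** Exchange argument: if a part [m] of [l] had a smaller representation [p], adding the remaining
    part of [l] to [p] would give a smaller representation for [l]. *)
Lemma lex_least_lower gens : lower (lex_least gens).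
Proof.
  intros l m Hml Hl p Hp E C Hlt.
  destruct (Forall2_le_ladd m l Hml) as [q [Hq ->]].
  apply (Hl (ladd p q)).
  - rewrite !ladd_length; congruence.
  - apply functional_extensionality; intros i; rewrite !lin_ladd, E by congruence; reflexivity.
  - intros i; rewrite !cnt_ladd, C by congruence; reflexivity.
  - apply ladd_lexlt; congruence.
Qed.

(* Khovanskii's theorem via the Nathanson-Ruzsa argument: each element of the sumset has a
   unique lexicographically least representation, and these form a lower set. *)
Theorem sumset_counted gens : exists cs, forall N, exists zs, NoDup zs /\
  (forall z, In z zs <-> reach gens N z) /\ length zs = cell_sum cs N.
Proof.
  destruct (lower_set_counted (map fst gens) _ (lex_least_lower gens)) as [cs Hcs].
  exists cs; intros N; destruct (Hcs N) as [ls [H1 [H2 H3]]]; clear Hcs.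
  rewrite length_map in H2. exists (map (lin gens) ls); split; [|split].
  - apply FinFun.Injective_map_NoDup_in; [|exact H1].
    intros l m Hl Hm E; apply H2 in Hl, Hm.
    destruct Hl as [Ll [Dl Cl]], Hm as [Lm [Dm Cm]].
    destruct (lexlt_total l m) as [H|[H|H]]; [congruence| |exact H|].
    + exfalso; apply (Dm l); auto; [congruence|intros i; now rewrite Cl, Cm].
    + exfalso; apply (Dl m); auto; [congruence|intros i; now rewrite Cl, Cm].
  - intros z; rewrite in_map_iff; split.
    + intros [l [<- Hl]]; apply H2 in Hl; exists l; tauto.
    + intros [l [Ll [Cl ->]]].
      destruct (lex_min_exists (length gens)
        (fun m => lin gens m = lin gens l /\ forall i, cnt (map fst gens) m i = N i))
        as [m [Lm [[Em Cm] Hmin]]]; [eauto|].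
      exists m; split; [exact Em|]. apply H2; repeat split; auto.
      intros p Lp Ep Cp; apply Hmin; [congruence|split; [congruence|]].
      intros i; now rewrite Cp.
  - now rewrite length_map.
Qed.

Definition iadd (z w : ipoint) : ipoint := fun i => (z i + w i)%Z.

Lemma reach_zero gens : reach gens (fun _ => O) (fun _ => 0%Z).
Proof.
  exists (repeat O (length gens)); split; [apply repeat_length|].
  assert (H : (forall i, cnt (map fst gens) (repeat O (length gens)) i = O) /\
              forall j, lin gens (repeat O (length gens)) j = 0%Z).
  { induction gens as [|[t v] gens [IH1 IH2]]; simpl; [auto|split].
    - intros i; rewrite IH1; now destruct (tri_eqb t i).
    - intros j; now rewrite IH2. }
  destruct H as [H1 H2]; split; [exact H1|].
  apply functional_extensionality; intros j; now rewrite H2.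
Qed.

Lemma reach_step gens N z t v : reach gens N z -> In (t, v) gens -> reach gens (inc t N) (iadd z v).
Proof.
  intros [l [Ll [Cl ->]]] Hin.
  assert (H : exists m, length m = length gens /\
    (forall i, cnt (map fst gens) m i = inc t (cnt (map fst gens) l) i) /\
    forall j, lin gens m j = (lin gens l j + v j)%Z).
  { clear Cl N; revert l Ll; induction gens as [|[t' v'] gens IH]; intros l Ll; [easy|].
    destruct l as [|k l]; [discriminate|]. injection Ll as Ll.
    destruct Hin as [E|Hin].
    - injection E as -> ->. exists (S k :: l); split; [simpl; congruence|split].
      + intros i; unfold inc; simpl; destruct (tri_eqb t i); simpl; lia.
      + intros j; cbn [lin]; rewrite Nat2Z.inj_succ; ring.
    - destruct (IH Hin l Ll) as [m [Lm [Cm Em]]].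
      exists (k :: m); simpl; split; [congruence|split].
      + intros i; rewrite Cm; unfold inc; destruct (tri_eqb t i); lia.
      + intros j; rewrite Em; lia. }
  destruct H as [m [Lm [Cm Em]]]; exists m; split; [exact Lm|split].
  - intros i; rewrite Cm; unfold inc; now rewrite Cl.
  - apply functional_extensionality; intros j; now rewrite Em.
Qed.

(** A representation is a multiset of generators, added here one at a time; this converts [reach]
    into the inductive predicate generated by [reach_zero] and [reach_step]. *)
Lemma reach_ind gens (P : (tri -> nat) -> ipoint -> Prop) :
  P (fun _ => O) (fun _ => 0%Z) ->
  (forall N z t v, P N z -> In (t, v) gens -> P (inc t N) (iadd z v)) ->
  forall N z, reach gens N z -> P N z.
Proof.
  intros H0 HS N z [l [Ll [Cl ->]]].
  assert (G : forall g m N0 z0, incl g gens -> length m = length g -> P N0 z0 ->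
    P (fun i => N0 i + cnt (map fst g) m i)%nat (iadd z0 (lin g m))).
  { clear l Ll Cl; induction g as [|[t v] g IH]; intros m N0 z0 Hg Lm HP.
    - destruct m; [|discriminate].
      replace (fun i => (N0 i + cnt (map fst nil) nil i)%nat) with N0.
      replace (iadd z0 (lin nil nil)) with z0; [exact HP|].
      + apply functional_extensionality; intros j; unfold iadd; simpl; lia.
      + apply functional_extensionality; intros j; simpl; lia.
    - destruct m as [|k m]; [discriminate|]. injection Lm as Lm.
      assert (Hk : P (fun i => N0 i + if tri_eqb t i then k else 0)%nat
                     (fun j => z0 j + Z.of_nat k * v j)%Z).
      { clear m Lm. induction k as [|k IHk].
        - replace (fun i => (N0 i + if tri_eqb t i then 0 else 0)%nat) with N0.
          replace (fun j => (z0 j + Z.of_nat 0 * v j)%Z) with z0; [exact HP|].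
          + apply functional_extensionality; intros j; lia.
          + apply functional_extensionality; intros j; destruct (tri_eqb t j); lia.
        - apply (HS _ _ t v) in IHk; [|apply Hg; now left].
          match goal with |- P ?a ?b => match type of IHk with P ?c ?d =>
            replace a with c; [replace b with d; [exact IHk|]|] end end.
          + apply functional_extensionality; intros j; unfold iadd.
            rewrite Nat2Z.inj_succ; ring.
          + apply functional_extensionality; intros i; unfold inc.
            destruct (tri_eqb t i); lia. }
      apply (IH m) in Hk; [|intros x Hx; apply Hg; now right|exact Lm].
      match goal with |- P ?a ?b => match type of Hk with P ?c ?d =>
        replace a with c; [replace b with d; [exact Hk|]|] end end.
      + apply functional_extensionality; intros j; unfold iadd; simpl; lia.
      + apply functional_extensionality; intros i; simpl; destruct (tri_eqb t i); lia. }
  specialize (G gens l (fun _ => O) (fun _ => 0%Z) (incl_refl gens) Ll H0).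
  match goal with |- P ?a ?b => match type of G with P ?c ?d =>
    replace a with c; [replace b with d; [exact G|]|] end end.
  - apply functional_extensionality; intros j; unfold iadd; lia.
  - apply functional_extensionality; intros i; now rewrite Cl.
Qed.

(** * Asymptotics of sumset cardinalities *)

Lemma bin_at_0 d : bin d 0 = 1%nat.
Proof. induction d; simpl; auto. Qed.

(** [bin (S d) m] is the binomial coefficient of m + d over d, and these are its absorption
    identities. The first at d gives the second at d by induction on m, and both at d give the first
    at d + 1. *)
Lemma bin_recurrences d :
  (forall m, S m * bin (S d) (S m) = (m + S d) * bin (S d) m)%nat /\
  (forall m, S d * bin (S (S d)) m = (m + S d) * bin (S d) m)%nat.
Proof.
  assert (QP : forall d, (forall m, S m * bin (S d) (S m) = (m + S d) * bin (S d) m)%nat ->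
    forall m, (S d * bin (S (S d)) m = (m + S d) * bin (S d) m)%nat).
  { clear d; intros d Q m; induction m as [|m IH]; [now rewrite !bin_at_0|].
    change (bin (S (S d)) (S m)) with (bin (S (S d)) m + bin (S d) (S m))%nat.
    rewrite Nat.mul_add_distr_l, IH, <- Q. ring. }
  induction d as [|d [Q P]].
  - assert (Q : forall m, (S m * bin 1 (S m) = (m + 1) * bin 1 m)%nat).
    { assert (E : forall m, bin 1 m = 1%nat) by (induction m; simpl in *; lia).
      intros m; rewrite !E; lia. }
    split; [exact Q|]. apply QP, Q.
  - assert (Q' : forall m, (S m * bin (S (S d)) (S m) = (m + S (S d)) * bin (S (S d)) m)%nat).
    { intros m. apply (Nat.mul_cancel_l _ _ (S d)); [lia|].
      transitivity (S m * (S d * bin (S (S d)) (S m)))%nat; [ring|].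
      rewrite P. transitivity ((m + S (S d)) * (S m * bin (S d) (S m)))%nat; [ring|].
      rewrite Q, <- P. ring. }
    split; [exact Q'|]. apply QP, Q'.
Qed.

(** This is 1/d!, the leading coefficient of [bin (S d)] as a polynomial of degree d. *)
Fixpoint bin_coef (d : nat) : R :=
  match d with O => 1 | S d => bin_coef d / INR (S d) end.

Lemma bin_coef_pos d : 0 < bin_coef d.
Proof.
  induction d; cbn [bin_coef]; [lra|]. apply Rdiv_lt_0_compat; [easy|apply lt_0_INR; lia].
Qed.

Lemma INR_S_pos k : 0 < INR (S k).
Proof. apply lt_0_INR; lia. Qed.

(** The second recurrence passes from d to d + 1 by a factor which, divided by [INR (S k)], tends to
    x/(d + 1); the bounded shift [q] is lost in the limit. *)
Lemma bin_lim d x q :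
  is_lim_seq (fun k => INR (bin (S d) (S k * x + q)) / INR (S k) ^ d) (bin_coef d * INR x ^ d).
Proof.
  induction d as [|d IH].
  - apply is_lim_seq_ext with (u := fun _ => 1); [|cbn [pow bin_coef]; rewrite Rmult_1_l; apply is_lim_seq_const].
    intros k. assert (E : forall m, bin 1 m = 1%nat) by (induction m; simpl in *; lia).
    rewrite E; simpl INR; rewrite pow_O; field.
  - replace (Finite (bin_coef (S d) * INR x ^ S d))
      with (Finite (bin_coef d * INR x ^ d * (INR x / INR (S d)))).
    2:{ f_equal; cbn [bin_coef pow]. field. apply Rgt_not_eq, INR_S_pos. }
    apply is_lim_seq_ext with (u := fun k => INR (bin (S d) (S k * x + q)) / INR (S k) ^ d
      * (INR x / INR (S d) + (INR q + INR (S d)) / INR (S d) / INR (S k))).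
    + intros k. destruct (bin_recurrences d) as [_ P].
      specialize (P (S k * x + q)%nat). apply (f_equal INR) in P.
      rewrite !mult_INR, !plus_INR, mult_INR in P.
      assert (E : INR (bin (S (S d)) (S k * x + q)) = (INR (S k) * INR x + INR q + INR (S d)) *
        INR (bin (S d) (S k * x + q)) / INR (S d)).
      { rewrite <- P; field. apply Rgt_not_eq, INR_S_pos. }
      rewrite E. pose proof (INR_S_pos k). pose proof (INR_S_pos d).
      cbn [pow]. field. repeat split; try apply pow_nonzero; lra.
    + apply is_lim_seq_mult'; [exact IH|apply lim_affine_div].
Qed.

Definition mono (i j l : nat) (N : tri -> nat) : R :=
  INR (N T1) ^ i * INR (N T2) ^ j * INR (N T3) ^ l.

Definition monos (n : nat) : list ((tri -> nat) -> R) :=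
  flat_map (fun i => map (fun j => mono i j (n - i - j)) (seq 0 (S (n - i)))) (seq 0 (S n)).

Lemma in_monos n g : In g (monos n) <-> exists i j l, (i + j + l = n)%nat /\ g = mono i j l.
Proof.
  unfold monos; rewrite in_flat_map; split.
  - intros [i [Hi Hg]]; apply in_map_iff in Hg; destruct Hg as [j [<- Hj]].
    apply in_seq in Hi, Hj. exists i, j, (n - i - j)%nat; split; [lia|reflexivity].
  - intros [i [j [l [H ->]]]]; exists i; split; [apply in_seq; lia|].
    apply in_map_iff; exists j; split; [f_equal; lia|apply in_seq; lia].
Qed.

(** * Cones of functions and their closedness *)

(** Nonnegative combinations of the list, with one coefficient peeled off at a time, so that
    closedness is proved by induction without vectors of coefficients. *)
Fixpoint cone {X : Type} (L : list (X -> R)) (f : X -> R) : Prop :=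
  match L with
  | nil => forall x, f x = 0
  | g :: L => exists c, 0 <= c /\ cone L (fun x => f x - c * g x)
  end.

Lemma cone_zero {X} (L : list (X -> R)) : cone L (fun _ => 0).
Proof.
  induction L as [|g L IH]; simpl; [auto|]. exists 0; split; [lra|].
  replace (fun x => 0 - 0 * g x) with (fun _ : X => 0); [exact IH|].
  apply functional_extensionality; intros x; ring.
Qed.

Lemma cone_in {X} (L : list (X -> R)) g c : In g L -> 0 <= c -> cone L (fun x => c * g x).
Proof.
  intros H Hc; induction L as [|h L IH]; simpl; [easy|]. destruct H as [->|H].
  - exists c; split; [exact Hc|].
    replace (fun x => c * g x - c * g x) with (fun _ : X => 0); [apply cone_zero|].
    apply functional_extensionality; intros x; ring.
  - exists 0; split; [lra|].
    replace (fun x => c * g x - 0 * h x) with (fun x => c * g x); [auto|].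
    apply functional_extensionality; intros x; ring.
Qed.

Lemma cone_plus {X} (L : list (X -> R)) f f' :
  cone L f -> cone L f' -> cone L (fun x => f x + f' x).
Proof.
  revert f f'; induction L as [|g L IH]; simpl; intros f f'.
  - intros H H' x; rewrite H, H'; ring.
  - intros [c [Hc H]] [c' [Hc' H']]; exists (c + c'); split; [lra|].
    replace (fun x => f x + f' x - (c + c') * g x)
      with (fun x => (f x - c * g x) + (f' x - c' * g x)); [auto|].
    apply functional_extensionality; intros x; ring.
Qed.

Lemma cone_scal {X} (L : list (X -> R)) a f : 0 <= a -> cone L f -> cone L (fun x => a * f x).
Proof.
  intros Ha; revert f; induction L as [|g L IH]; simpl; intros f.
  - intros H x; rewrite H; ring.
  - intros [c [Hc H]]; exists (a * c); split; [now apply Rmult_le_pos|].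
    replace (fun x => a * f x - a * c * g x)
      with (fun x => a * (f x - c * g x)); [auto|].
    apply functional_extensionality; intros x; ring.
Qed.

Lemma cone_nonneg {X} (L : list (X -> R)) f x :
  (forall g, In g L -> 0 <= g x) -> cone L f -> 0 <= f x.
Proof.
  revert f; induction L as [|g L IH]; simpl; intros f HL.
  - intros H; rewrite H; lra.
  - intros [c [Hc H]]. apply IH in H; [|intros; apply HL; now right].
    assert (0 <= c * g x) by (apply Rmult_le_pos; [exact Hc|apply HL; now left]). lra.
Qed.

Lemma convergent_subsequence (u : nat -> R) B : (forall k, 0 <= u k <= B) ->
  exists l phi, 0 <= l /\ (forall k, (k <= phi k)%nat) /\ is_lim_seq (fun k => u (phi k)) l.
Proof.
  intros Hu.
  destruct (Bolzano_Weierstrass u _ (compact_P3 0 B) Hu) as [l Hl].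
  destruct (choice (fun k p => (k <= p)%nat /\ Rabs (u p - l) < / INR (S k))) as [phi Hphi].
  { intros k.
    assert (Hd : 0 < / INR (S k)) by apply Rinv_0_lt_compat, INR_S_pos.
    apply (Hl (disc l (mkposreal _ Hd))). exists (mkposreal _ Hd). intros y Hy; exact Hy. }
  assert (Hlim : is_lim_seq (fun k => u (phi k)) l).
  { apply is_lim_seq_le_le with (u := fun k => l + (-1) / INR (S k)) (w := fun k => l + 1 / INR (S k)).
    - intros k; destruct (Hphi k) as [_ H]. apply Rabs_lt_between in H. unfold Rdiv; lra.
    - apply lim_affine_div.
    - apply lim_affine_div. }
  exists l, phi; split; [|split; [intros k; apply Hphi|exact Hlim]].
  apply (lim_le_const _ _ _ Hlim); intros k; apply Hu.
Qed.

Lemma lim_subsequence (u : nat -> R) (l : R) phi : (forall k, (k <= phi k)%nat) ->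
  is_lim_seq u l -> is_lim_seq (fun k => u (phi k)) l.
Proof.
  intros Hphi Hu. apply (is_lim_seq_subseq u l phi); [|exact Hu].
  intros P [N HN]; exists N; intros k Hk; apply HN. specialize (Hphi k); lia.
Qed.

Lemma lim_bounded (u : nat -> R) (l : R) : is_lim_seq u l -> exists B, forall k, u k <= B.
Proof.
  intros Hu. apply is_lim_seq_spec in Hu. destruct (Hu (mkposreal 1 Rlt_0_1)) as [N HN].
  simpl in HN.
  assert (HB : exists B, forall k, (k < N)%nat -> u k <= B).
  { clear HN; induction N as [|N [B IH]]; [exists 0; intros; lia|].
    exists (Rmax B (u N)); intros k Hk. destruct (Nat.eq_dec k N) as [->|]; [apply Rmax_r|].
    eapply Rle_trans; [apply IH; lia|apply Rmax_l]. }
  destruct HB as [B HB]; exists (Rmax B (l + 1)); intros k.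
  destruct (lt_dec k N) as [Hk|Hk].
  - eapply Rle_trans; [now apply HB|apply Rmax_l].
  - eapply Rle_trans; [|apply Rmax_r]. specialize (HN k ltac:(lia)).
    apply Rabs_lt_between in HN; lra.
Qed.

(** At [x0] all generators are positive, so the convergent values f k x0 bound the first
    coefficient. A subsequence of it converges; subtracting its term leaves the same problem for the
    shorter list. *)
Lemma cone_closed {X} (L : list (X -> R)) (x0 : X) (f : nat -> X -> R) (f' : X -> R) :
  (forall g, In g L -> 0 < g x0) -> (forall k, cone L (f k)) ->
  (forall x, is_lim_seq (fun k => f k x) (f' x)) -> cone L f'.
Proof.
  revert f f'; induction L as [|g L IH]; intros f f' HL Hf Hlim.
  - simpl in *; intros x. specialize (Hlim x).
    apply is_lim_seq_ext with (v := fun _ => 0) in Hlim; [|intros k; apply Hf].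
    apply is_lim_seq_unique in Hlim. rewrite Lim_seq_const in Hlim. congruence.
  - simpl in Hf. apply choice in Hf; destruct Hf as [c Hc].
    assert (Hg : 0 < g x0) by (apply HL; now left).
    destruct (lim_bounded _ _ (Hlim x0)) as [B HB].
    destruct (convergent_subsequence c (B / g x0)) as [l [phi [Hl [Hphi Hcl]]]].
    { intros k; destruct (Hc k) as [Hc0 Hck]; split; [exact Hc0|].
      (* The remainder is nonnegative at [x0], hence c k times g x0 is at most f k x0. *)
      apply (cone_nonneg L _ x0) in Hck; [|intros h Hh; apply Rlt_le, HL; now right].
      apply Rmult_le_reg_r with (g x0); [exact Hg|].
      unfold Rdiv; rewrite Rmult_assoc, Rinv_l by lra. specialize (HB k); lra. }
    exists l; split; [exact Hl|].
    apply (IH (fun k x => f (phi k) x - c (phi k) * g x)).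
    + intros h Hh; apply HL; now right.
    + intros k; apply Hc.
    + intros x; apply is_lim_seq_minus'.
      * now apply (lim_subsequence (fun k => f k x)).
      * apply is_lim_seq_mult'; [exact Hcl|apply is_lim_seq_const].
Qed.

(** The shift [r] carries every multiplicity, including those with N i = 0, past the apexes of all
    cells, where the counts are honest polynomials. *)
Definition dilate (k r : nat) (N : tri -> nat) : tri -> nat := fun i => (S k * N i + r)%nat.

(** [pred] because [bin d] has degree d - 1 for positive d. *)
Definition cell_deg (c : cell) : nat :=
  (pred (snd c T1) + pred (snd c T2) + pred (snd c T3))%nat.

Definition cell_coef (c : cell) : R :=
  bin_coef (pred (snd c T1)) * bin_coef (pred (snd c T2)) * bin_coef (pred (snd c T3)).

Lemma cell_lim c r N : (forall i, (fst c i < r)%nat) -> (forall i, (1 <= snd c i)%nat) ->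
  is_lim_seq (fun k => INR (cell_count c (dilate k r N)) / INR (S k) ^ cell_deg c)
    (cell_coef c * mono (pred (snd c T1)) (pred (snd c T2)) (pred (snd c T3)) N).
Proof.
  intros Hr Hd; destruct c as [a d]; simpl in Hr, Hd.
  unfold cell_coef, cell_deg, mono; simpl fst; simpl snd.
  assert (E : forall k i, shifted_bin (a i) (d i) (dilate k r N i)
     = bin (S (pred (d i))) (S k * N i + (r - a i))).
  { intros k i; specialize (Hr i); specialize (Hd i). unfold shifted_bin, dilate.
    destruct (Nat.ltb_spec (S k * N i + r) (a i)); [lia|]. f_equal; lia. }
  match goal with |- is_lim_seq _ (Finite ?v) => replace v with
    ((bin_coef (pred (d T1)) * INR (N T1) ^ pred (d T1)) *
     (bin_coef (pred (d T2)) * INR (N T2) ^ pred (d T2)) *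
     (bin_coef (pred (d T3)) * INR (N T3) ^ pred (d T3))) by ring end.
  eapply is_lim_seq_ext; [|exact (is_lim_seq_mult' _ _ _ _ (is_lim_seq_mult' _ _ _ _
    (bin_lim _ _ (r - a T1)) (bin_lim _ _ (r - a T2))) (bin_lim _ _ (r - a T3)))].
  intros k; unfold cell_count; simpl fst; simpl snd. rewrite !E, !mult_INR, !pow_add.
  cbv beta. assert (Hk : INR (S k) <> 0) by apply Rgt_not_eq, INR_S_pos.
  field. repeat split; now apply pow_nonzero.
Qed.

(** Without a free direction of type [i] the multiplicity must equal the apex, which the shift has
    already passed. *)
Lemma cell_count_degenerate c r N i : (forall i, (fst c i < r)%nat) -> snd c i = O ->
  forall k, cell_count c (dilate k r N) = O.
Proof.
  intros Hr Hi k; specialize (Hr i). destruct c as [a d]; simpl in *.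
  assert (E : shifted_bin (a i) (d i) (dilate k r N i) = O).
  { unfold shifted_bin, dilate. destruct (_ <? _)%nat; [reflexivity|]. rewrite Hi; cbn [bin].
    destruct (Nat.eqb_spec (S k * N i + r - a i) 0); lia. }
  unfold cell_count; simpl. destruct i; rewrite E; ring.
Qed.

(** After division by the n-th power, a cell of degree below [n] vanishes in the limit and one of
    degree [n] leaves its leading monomial. A larger degree contradicts the growth bound, although
    that is assumed at a single [N] only. *)
Lemma cell_top_degree c n r C : (forall i, (fst c i < r)%nat) ->
  (forall k, INR (cell_count c (dilate k r (fun _ => 1%nat))) <= C * INR (S k) ^ n) ->
  exists g, cone (monos n) g /\
    forall N, is_lim_seq (fun k => INR (cell_count c (dilate k r N)) / INR (S k) ^ n) (g N).
Proof.
  intros Hr HC.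
  destruct (classic (exists i, snd c i = O)) as [[i Hi]|Hd].
  { exists (fun _ => 0); split; [apply cone_zero|]. intros N.
    apply is_lim_seq_ext with (u := fun _ => 0); [|apply is_lim_seq_const].
    intros k; rewrite (cell_count_degenerate c r N i Hr Hi); simpl INR; unfold Rdiv; ring. }
  assert (Hd' : forall i, (1 <= snd c i)%nat).
  { intros i; destruct (snd c i) eqn:E; [exfalso; eauto|lia]. }
  pose proof (fun N => cell_lim c r N Hr Hd') as Hlim.
  assert (Hcoef : 0 < cell_coef c)
    by (unfold cell_coef; repeat apply Rmult_lt_0_compat; apply bin_coef_pos).
  destruct (lt_eq_lt_dec (cell_deg c) n) as [[Hlt|Heq]|Hgt].
  - exists (fun _ => 0); split; [apply cone_zero|]. intros N.
    replace (Finite 0) with (Finite (cell_coef c * mono (pred (snd c T1)) (pred (snd c T2))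
       (pred (snd c T3)) N * (0 * 0 ^ (n - cell_deg c - 1)))) by (f_equal; ring).
    apply is_lim_seq_ext with (u := fun k => INR (cell_count c (dilate k r N))
      / INR (S k) ^ cell_deg c * (1 / INR (S k) * (1 / INR (S k)) ^ (n - cell_deg c - 1))).
    + intros k. replace n with (cell_deg c + S (n - cell_deg c - 1))%nat at 2 by lia.
      pose proof (INR_S_pos k).
      rewrite pow_add, <- tech_pow_Rmult. unfold Rdiv at 3; rewrite Rmult_1_l, pow_inv.
      field. repeat split; try apply pow_nonzero; lra.
    + apply is_lim_seq_mult'; [apply Hlim|]. apply is_lim_seq_mult'; [apply lim_const_div|].
      generalize (n - cell_deg c - 1)%nat; intros m; induction m as [|m IH].
      * apply is_lim_seq_const.
      * apply is_lim_seq_mult'; [apply lim_const_div|exact IH].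
  - exists (fun N => cell_coef c *
      mono (pred (snd c T1)) (pred (snd c T2)) (pred (snd c T3)) N); split.
    + apply cone_in; [|lra]. apply in_monos. unfold cell_deg in Heq; eauto 6.
    + subst n; exact Hlim.
  (* Divided by the power [cell_deg c], the count is at most C/(k + 1), so its limit would be at
     most 0; at multiplicities (1,1,1) that limit is the positive [cell_coef c]. *)
  - exfalso. specialize (Hlim (fun _ => 1%nat)).
    assert (H0 : cell_coef c * mono (pred (snd c T1)) (pred (snd c T2)) (pred (snd c T3))
       (fun _ => 1%nat) <= 0).
    { assert (C0 : 0 <= C).
      { specialize (HC O). simpl INR in HC; rewrite pow1 in HC.
        pose proof (pos_INR (cell_count c (dilate 0 r (fun _ => 1%nat)))); lra. }
      apply (is_lim_seq_le _ (fun k => C / INR (S k)) _ 0 ) in Hlim; [exact Hlim| |apply lim_const_div].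
      intros k. pose proof (INR_S_pos k) as Hk.
      assert (Hk1 : 1 <= INR (S k)) by (rewrite S_INR; pose proof (pos_INR k); lra).
      apply Rmult_le_reg_r with (INR (S k) ^ cell_deg c); [now apply pow_lt|].
      unfold Rdiv; rewrite Rmult_assoc, Rinv_l, Rmult_1_r by (apply pow_nonzero; lra).
      eapply Rle_trans; [apply HC|].
      rewrite Rmult_assoc; apply Rmult_le_compat_l; [exact C0|].
      replace (cell_deg c) with (S (pred (cell_deg c))) by lia.
      rewrite <- tech_pow_Rmult, <- Rmult_assoc, Rinv_l, Rmult_1_l by lra.
      apply Rle_pow; [exact Hk1|lia]. }
    unfold mono in H0; simpl INR in H0; rewrite !pow1 in H0; lra.
Qed.

(** Counts are nonnegative, so the growth bound for the sum holds for each cell and no cancellation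
    between high degrees can occur. *)
Lemma cells_top_degree cs n r C : (forall c i, In c cs -> (fst c i < r)%nat) ->
  (forall k, INR (cell_sum cs (dilate k r (fun _ => 1%nat))) <= C * INR (S k) ^ n) ->
  exists g, cone (monos n) g /\
    forall N, is_lim_seq (fun k => INR (cell_sum cs (dilate k r N)) / INR (S k) ^ n) (g N).
Proof.
  induction cs as [|c cs IH]; intros Hr HC.
  - exists (fun _ => 0); split; [apply cone_zero|]. intros N.
    apply is_lim_seq_ext with (u := fun _ => 0); [|apply is_lim_seq_const].
    intros k; unfold cell_sum; simpl; unfold Rdiv; ring.
  - assert (E : forall M, INR (cell_sum (c :: cs) M) = INR (cell_count c M) + INR (cell_sum cs M))
      by (intros; unfold cell_sum; simpl; now rewrite plus_INR).
    destruct (cell_top_degree c n r C) as [g [Hg Lg]].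
    { intros i; apply Hr; now left. }
    { intros k; specialize (HC k); rewrite E in HC.
      pose proof (pos_INR (cell_sum cs (dilate k r (fun _ => 1%nat)))); lra. }
    destruct IH as [g' [Hg' Lg']].
    { intros; apply Hr; now right. }
    { intros k; specialize (HC k); rewrite E in HC.
      pose proof (pos_INR (cell_count c (dilate k r (fun _ => 1%nat)))); lra. }
    exists (fun N => g N + g' N); split; [now apply cone_plus|]. intros N.
    eapply is_lim_seq_ext; [|apply is_lim_seq_plus'; [apply Lg|apply Lg']].
    intros k; simpl; rewrite E; unfold Rdiv; ring.
Qed.

Lemma cells_offset_bound (cs : list cell) : exists r, forall c i, In c cs -> (fst c i < r)%nat.
Proof.
  induction cs as [|c cs [r Hr]]; [exists O; easy|].
  exists (S (Nat.max r (Nat.max (fst c T1) (Nat.max (fst c T2) (fst c T3))))).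
  intros c' i [<-|H]; [destruct i; lia|]. specialize (Hr c' i H); lia.
Qed.

(** * Volumes of Minkowski combinations are polynomials *)

Definition comb_pt (N : tri -> nat) (p : tri -> point) : point :=
  fun i => INR (N T1) * p T1 i + INR (N T2) * p T2 i + INR (N T3) * p T3 i.

(** One weighted point per body instead of [N t] separate summands; for nonempty convex bodies this
    is the repeated Minkowski sum, by [comb_zero] and [msum_comb]. *)
Definition comb (B : tri -> pset) (N : tri -> nat) : pset :=
  fun x => exists p, (forall t, B t (p t)) /\ x = comb_pt N p.

Definition total (N : tri -> nat) : R := INR (N T1) + INR (N T2) + INR (N T3).

Lemma comb_pt_inc t N p i : comb_pt (inc t N) p i = comb_pt N p i + p t i.
Proof. unfold comb_pt, inc; destruct t; simpl tri_eqb; cbn iota; rewrite S_INR; ring. Qed.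

Lemma total_inc t N : total (inc t N) = total N + 1.
Proof. unfold total, inc; destruct t; simpl tri_eqb; cbn iota; rewrite S_INR; ring. Qed.

(** The inclusion of m K + K in (m + 1) K, by a convex combination with weight 1/(m + 1). *)
Lemma convex_absorb (K : pset) (x y : point) m : convex K -> K x -> K y ->
  exists z, K z /\ forall i, INR (S m) * z i = INR m * x i + y i.
Proof.
  intros HK Hx Hy. pose proof (INR_S_pos m) as Hm.
  exists (padd (pscal (1 - / INR (S m)) x) (pscal (/ INR (S m)) y)); split.
  - apply HK; auto. split; [now apply Rlt_le, Rinv_0_lt_compat|].
    rewrite <- Rinv_1; apply Rinv_le_contravar; [lra|].
    rewrite S_INR; pose proof (pos_INR m); lra.
  - intros i; unfold padd, pscal.
    assert (E : INR m = INR (S m) - 1) by (rewrite S_INR; ring). rewrite E. field; lra.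
Qed.

Lemma comb_absorb B N t (p : tri -> point) (q : point) : (forall s, convex (B s)) ->
  (forall s, B s (p s)) -> B t q ->
  exists p', (forall s, B s (p' s)) /\
    forall i, comb_pt (inc t N) p' i = comb_pt N p i + q i.
Proof.
  intros HB Hp Hq.
  destruct (convex_absorb (B t) (p t) q (N t) (HB t) (Hp t) Hq) as [z [Hz Ez]].
  exists (fun s => match t, s return point with
    | T1, T1 | T2, T2 | T3, T3 => z | _, _ => p s end); split.
  - intros s; destruct t, s; auto.
  - intros i; specialize (Ez i). unfold comb_pt, inc; destruct t; simpl tri_eqb; cbn iota;
      rewrite Ez; ring.
Qed.

Lemma tri_nat_ind (P : (tri -> nat) -> Prop) :
  P (fun _ => O) -> (forall N t, P N -> P (inc t N)) -> forall N, P N.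
Proof.
  intros H0 HS N.
  set (mk := fun a b c t => match t with T1 => a | T2 => b | T3 => c end : nat).
  assert (H : forall a b c, P (mk a b c)).
  { assert (E : forall t a b c, inc t (mk a b c) =
      match t with T1 => mk (S a) b c | T2 => mk a (S b) c | T3 => mk a b (S c) end).
    { intros t a b c; apply functional_extensionality; intros s; destruct t, s; reflexivity. }
    induction a as [|a IHa]; [induction b as [|b IHb]; [induction c as [|c IHc]|]|].
    - replace (mk O O O) with (fun _ : tri => O); [exact H0|].
      apply functional_extensionality; intros []; reflexivity.
    - rewrite <- (E T3); auto.
    - intros c; rewrite <- (E T2); auto.
    - intros b c; rewrite <- (E T1); auto. }
  replace N with (mk (N T1) (N T2) (N T3)); [apply H|].
  apply functional_extensionality; intros []; reflexivity.
Qed.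

Definition lattice_near (n : nat) (M : R) (K : pset) (z : ipoint) : Prop :=
  supported n z /\ exists p, K p /\ forall i, (i < n)%nat -> Rabs (IZR (z i) - M * p i) <= 1.

Definition near_gens (n : nat) (M : R) (B : tri -> pset) (g : list (tri * ipoint)) : Prop :=
  forall t z, In (t, z) g <-> lattice_near n M (B t) z.

Lemma near_gens_exist n M B : 0 < M -> (forall t, bounded n (B t)) ->
  exists g, near_gens n M B g.
Proof.
  intros HM HB.
  assert (H : forall t, exists l, forall z, In z l <-> lattice_near n M (B t) z).
  { intros t; destruct (HB t) as [b Hb].
    destruct (finite_enum (lattice_near n M (B t))
      (grid n (fun _ => - (M * b) - 1) (fun _ => M * b + 1))) as [l [_ Hl]]; [|eauto].
    intros z [Hs [p [Hp Hz]]]; apply in_grid; split; [exact Hs|]. intros i Hi.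
    specialize (Hz i Hi); specialize (Hb p Hp i Hi).
    apply Rabs_le_between in Hz; apply Rabs_le_between in Hb.
    assert (M * - b <= M * p i) by (apply Rmult_le_compat_l; lra).
    assert (M * p i <= M * b) by (apply Rmult_le_compat_l; lra). lra. }
  apply choice in H; destruct H as [l Hl].
  exists (flat_map (fun t => map (pair t) (l t)) (T1 :: T2 :: T3 :: nil)).
  intros t z; rewrite <- Hl, in_flat_map; split.
  - intros [t' [_ H]]; apply in_map_iff in H; destruct H as [z' [E H]]. congruence.
  - intros H; exists t; split; [destruct t; simpl; auto|]. now apply in_map.
Qed.

(* The increments of [floor] along partial sums of points of [M B] are lattice points
   within distance 1 of [M B]. *)
Lemma reach_floor n M B g p N : near_gens n M B g -> (forall t, B t (p t)) ->
  reach g N (floor_pt n M (comb_pt N p)).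
Proof.
  intros Hg Hp; pattern N; apply tri_nat_ind.
  - replace (floor_pt n M (comb_pt (fun _ => O) p)) with (fun _ : nat => 0%Z); [apply reach_zero|].
    apply functional_extensionality; intros i; unfold floor_pt, comb_pt.
    destruct (lt_dec i n); [|reflexivity]. apply Int_part_spec; cbn [INR].
    replace (M * (0 * p T1 i + 0 * p T2 i + 0 * p T3 i)) with 0 by ring. lra.
  - clear N; intros N t IH.
    set (z := floor_pt n M (comb_pt N p)) in *.
    set (z' := floor_pt n M (comb_pt (inc t N) p)).
    replace z' with (iadd z (fun i => z' i - z i)%Z)
      by (apply functional_extensionality; intros i; unfold iadd; lia).
    apply reach_step; [exact IH|]. apply Hg; split.
    + intros i Hi; unfold z, z'; rewrite !floor_pt_supported by assumption; lia.
    + exists (p t); split; [apply Hp|]. intros i Hi.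
      pose proof (floor_pt_spec n M (comb_pt N p) i Hi) as H1.
      pose proof (floor_pt_spec n M (comb_pt (inc t N) p) i Hi) as H2.
      fold z in H1; fold z' in H2. rewrite comb_pt_inc, Rmult_plus_distr_l in H2.
      rewrite minus_IZR. apply Rabs_le_between; lra.
Qed.

(** Each generator is off by at most 1, which adds up to [total N]; convexity merges the points of
    one body into a single weighted point. *)
Lemma reach_near n M B g N z : near_gens n M B g -> (forall t, convex (B t)) ->
  (forall t, exists x, B t x) -> reach g N z ->
  supported n z /\ exists p, (forall t, B t (p t)) /\
    forall i, (i < n)%nat -> Rabs (IZR (z i) - M * comb_pt N p i) <= total N.
Proof.
  intros Hg Hc Hne; revert N z; apply reach_ind.
  - split; [intros i _; reflexivity|].
    apply choice in Hne; destruct Hne as [p Hp]; exists p; split; [exact Hp|].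
    intros i _; unfold comb_pt, total; cbn [INR]. apply Req_le.
    replace (0 - M * (0 * p T1 i + 0 * p T2 i + 0 * p T3 i)) with 0 by ring.
    rewrite Rabs_R0; ring.
  - intros N z t v [Hs [p [Hp Hz]]] Hin. apply Hg in Hin; destruct Hin as [Hv [q [Hq Hvq]]].
    split; [intros i Hi; unfold iadd; rewrite Hs, Hv by assumption; reflexivity|].
    destruct (comb_absorb B N t p q Hc Hp Hq) as [p' [Hp' Ep]].
    exists p'; split; [exact Hp'|]. intros i Hi; rewrite Ep, total_inc.
    unfold iadd; rewrite plus_IZR.
    replace (IZR (z i) + IZR (v i) - M * (comb_pt N p i + q i))
      with ((IZR (z i) - M * comb_pt N p i) + (IZR (v i) - M * q i)) by ring.
    eapply Rle_trans; [apply Rabs_triang|]. apply Rplus_le_compat; auto.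
Qed.

Lemma reach_add g N N' z w : reach g N z -> reach g N' w ->
  reach g (fun i => N i + N' i)%nat (iadd z w).
Proof.
  intros Hz Hw; revert N z Hz; apply reach_ind.
  - replace (iadd (fun _ => 0%Z) w) with w; [exact Hw|].
    apply functional_extensionality; intros i; unfold iadd; lia.
  - intros N z t v H Hin. apply (reach_step _ _ _ _ _ H) in Hin.
    match goal with |- reach _ ?a ?b => match type of Hin with reach _ ?c ?d =>
      replace a with c; [replace b with d; [exact Hin|]|] end end.
    + apply functional_extensionality; intros i; unfold iadd; lia.
    + apply functional_extensionality; intros i; unfold inc; destruct (tri_eqb t i); lia.
Qed.

Lemma comb_bounded n B N : (forall t, bounded n (B t)) -> bounded n (comb B N).
Proof.
  intros HB; destruct (HB T1) as [b1 H1], (HB T2) as [b2 H2], (HB T3) as [b3 H3].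
  exists (INR (N T1) * b1 + INR (N T2) * b2 + INR (N T3) * b3).
  intros x [p [Hp ->]] i Hi; unfold comb_pt.
  repeat (eapply Rle_trans; [apply Rabs_triang|]; apply Rplus_le_compat);
    rewrite Rabs_mult, (Rabs_pos_eq (INR _)) by apply pos_INR;
    (apply Rmult_le_compat_l; [apply pos_INR|]); auto.
Qed.

Lemma comb_dilate N k r p i :
  comb_pt (dilate k r N) p i = INR (S k) * comb_pt N p i + comb_pt (fun _ => r) p i.
Proof.
  unfold comb_pt, dilate; rewrite !plus_INR, !mult_INR; ring.
Qed.

(** Rounding down a point of [comb B N] scaled by M(k + 1) lands in the sumset with multiplicities
    (k + 1) N, so the cubes over that sumset cover. *)
Lemma volume_le_count n M B g N k r zs : 0 < M -> near_gens n M B g ->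
  (forall t, bounded n (B t)) -> (forall t, exists x, B t x) ->
  (forall z, In z zs <-> reach g (dilate k r N) z) ->
  volume n (comb B N) <= INR (length zs) / (M * INR (S k)) ^ n.
Proof.
  intros HM Hg HB Hne Hzs. pose proof (INR_S_pos k) as Hk.
  assert (HT : 0 < M * INR (S k)) by now apply Rmult_lt_0_compat.
  apply choice in Hne; destruct Hne as [p0 Hp0].
  pose proof (reach_floor n M B g p0 (fun _ => r) Hg Hp0) as Hw.
  (* One fixed element using [r] summands of each type. Adding it makes up the shift in
     [dilate k r N], and translating [zs] back by it keeps the cardinality. *)
  set (w := floor_pt n M (comb_pt (fun _ => r) p0)) in *.
  rewrite <- (length_map (fun z => iadd z (fun i => - w i)%Z) zs), <- cubes_vol by assumption.
  apply volume_le_cover; [now apply comb_bounded|now apply cubes_ok|].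
  intros x [p [Hp ->]]. apply Exists_exists.
  exists (cube (M * INR (S k)) (floor_pt n (M * INR (S k)) (comb_pt N p))).
  split; [|now apply floor_pt_cube]. apply in_map, in_map_iff.
  exists (iadd (floor_pt n (M * INR (S k)) (comb_pt N p)) w); split.
  - apply functional_extensionality; intros i; unfold iadd; lia.
  - apply Hzs.
    replace (dilate k r N) with (fun i => (S k * N i) + r)%nat by reflexivity.
    apply (reach_add g (fun i => S k * N i)%nat (fun _ => r)); [|exact Hw].
    replace (floor_pt n (M * INR (S k)) (comb_pt N p))
      with (floor_pt n M (comb_pt (fun i => S k * N i)%nat p)).
    + now apply reach_floor with B.
    + apply functional_extensionality; intros i; unfold floor_pt.
      destruct (lt_dec i n); [|reflexivity]. f_equal. unfold comb_pt.
      rewrite !mult_INR; ring.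
Qed.

(** The rounding error grows like (k + 1) total N. Relative to the scale M(k + 1) it is total N / M
    at either end of a side, independent of k, and everything else is O(1/k). *)
Lemma count_le_cover n M B g N r : 0 < M -> near_gens n M B g ->
  (forall t, bounded n (B t)) -> (forall t, exists x, B t x) -> (forall t, convex (B t)) ->
  exists E, 0 <= E /\ forall bs k zs, Forall (box_ok n) bs -> covers n bs (comb B N) ->
  NoDup zs -> (forall z, In z zs -> reach g (dilate k r N) z) ->
  INR (length zs) / (M * INR (S k)) ^ n <=
  lsum (fun ab => prodn n (fun i => snd ab i - fst ab i + 2 * total N / M + E / INR (S k))) bs.
Proof.
  intros HM Hg HB Hne Hc.
  destruct (comb_bounded n B (fun _ => r) HB) as [b Hb].
  assert (Htot : 0 <= total N).
  { unfold total; pose proof (pos_INR (N T1)); pose proof (pos_INR (N T2));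
      pose proof (pos_INR (N T3)); lra. }
  (* The cost of the shift: 3 r more summands, each rounded by at most 1, and a displacement by [M]
     times a point with coordinates bounded by [b]. *)
  set (E0 := 3 * INR r + M * Rabs b). assert (HE0 : 0 <= E0).
  { unfold E0; pose proof (pos_INR r).
    assert (0 <= M * Rabs b) by (apply Rmult_le_pos; [lra|apply Rabs_pos]). lra. }
  exists ((2 * E0 + 1) / M); split.
  { apply Rmult_le_pos; [lra|now apply Rlt_le, Rinv_0_lt_compat]. }
  intros bs k zs Hok Hcov Hnd Hz. pose proof (INR_S_pos k) as Hk.
  assert (HT : 0 < M * INR (S k)) by now apply Rmult_lt_0_compat.
  eapply Rle_trans; [apply (count_in_boxes n zs bs (M * INR (S k)) (INR (S k) * total N + E0))|].
  - exact HT.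
  - assert (0 <= INR (S k) * total N) by (apply Rmult_le_pos; lra). lra.
  - exact Hnd.
  - exact Hok.
  - intros z Hzz; apply Hz in Hzz.
    destruct (reach_near n M B g _ z Hg Hc Hne Hzz) as [Hs [p [Hp Hzp]]]; split; [exact Hs|].
    assert (Hx : comb B N (comb_pt N p)) by (exists p; auto).
    apply Hcov in Hx. eapply Exists_impl; [|exact Hx]. intros ab Hab i Hi.
    specialize (Hab i Hi); specialize (Hzp i Hi). rewrite comb_dilate in Hzp.
    specialize (Hb (comb_pt (fun _ => r) p) (ex_intro _ p (conj Hp eq_refl)) i Hi).
    set (x := comb_pt N p i) in *. set (y := comb_pt (fun _ => r) p i) in *.
    assert (Hy : - Rabs b <= y <= Rabs b).
    { apply Rabs_le_between; pose proof (Rle_abs b); lra. }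
    assert (M * - Rabs b <= M * y) by (apply Rmult_le_compat_l; lra).
    assert (M * y <= M * Rabs b) by (apply Rmult_le_compat_l; lra).
    assert (M * INR (S k) * fst ab i <= M * INR (S k) * x)
      by (apply Rmult_le_compat_l; [lra|apply Hab]).
    assert (M * INR (S k) * x <= M * INR (S k) * snd ab i)
      by (apply Rmult_le_compat_l; [lra|apply Hab]).
    assert (Et : total (dilate k r N) = INR (S k) * total N + 3 * INR r).
    { unfold total, dilate; rewrite !plus_INR, !mult_INR; ring. }
    rewrite Et in Hzp. apply Rabs_le_between in Hzp. unfold E0.
    replace (M * (INR (S k) * x + y)) with (M * INR (S k) * x + M * y) in Hzp by ring.
    lra.
  - right; apply lsum_ext; intros ab _; apply prodn_ext; intros i _.
    rewrite Rplus_assoc; f_equal. field; lra.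
Qed.

(** The mesh [M] is fixed and k tends to infinity: the limit of the normalised counts lies in the
    cone and is squeezed between the volume and every cover widened by [2 * total N / M]. *)
Lemma volume_comb_approx n M B : 0 < M ->
  (forall t, bounded n (B t)) -> (forall t, exists x, B t x) -> (forall t, convex (B t)) ->
  exists f, cone (monos n) f /\ forall N, volume n (comb B N) <= f N /\
    forall bs, Forall (box_ok n) bs -> covers n bs (comb B N) ->
    f N <= lsum (fun ab => prodn n (fun i => snd ab i - fst ab i + 2 * total N / M)) bs.
Proof.
  intros HM HB Hne Hc.
  destruct (near_gens_exist n M B HM HB) as [g Hg].
  destruct (sumset_counted g) as [cs Hcs].
  destruct (cells_offset_bound cs) as [r Hr].
  assert (HMn : 0 < M ^ n) by now apply pow_lt.
  (* The growth bound that excludes cells of degree above [n]. Any finite cover provides it, with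
     [E] in place of E/(k + 1) for uniformity in k. *)
  assert (HC : exists C, forall k,
    INR (cell_sum cs (dilate k r (fun _ => 1%nat))) <= C * INR (S k) ^ n).
  { destruct (count_le_cover n M B g (fun _ => 1%nat) r HM Hg HB Hne Hc) as [E [HE H]].
    destruct (volume_cover_approx n (comb B (fun _ => 1%nat)) 1) as [bs [H1 [H2 _]]];
      [now apply comb_bounded|lra|].
    exists (M ^ n * lsum (fun ab => prodn n (fun i => snd ab i - fst ab i
       + 2 * total (fun _ => 1%nat) / M + E)) bs).
    intros k; destruct (Hcs (dilate k r (fun _ => 1%nat))) as [zs [Hnd [Hz <-]]].
    specialize (H bs k zs H1 H2 Hnd (fun z => proj1 (Hz z))).
    pose proof (INR_S_pos k) as Hk. assert (Hkn : 0 < INR (S k) ^ n) by now apply pow_lt.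
    rewrite Rpow_mult_distr in H. apply Rmult_le_reg_r with (/ (M ^ n * INR (S k) ^ n)).
    { apply Rinv_0_lt_compat; now apply Rmult_lt_0_compat. }
    eapply Rle_trans; [exact H|].
    match goal with |- _ <= M ^ n * ?v * _ * _ =>
      replace (M ^ n * v * INR (S k) ^ n * / (M ^ n * INR (S k) ^ n)) with v
        by (field; split; lra) end.
    apply lsum_le; intros ab Hab; apply prodn_le; intros i Hi.
    rewrite Forall_forall in H1; specialize (H1 ab Hab i Hi).
    assert (0 <= E / INR (S k) <= E).
    { split; [apply Rmult_le_pos; [lra|now apply Rlt_le, Rinv_0_lt_compat]|].
      rewrite <- (Rmult_1_r E) at 2. apply Rmult_le_compat_l; [lra|].
      rewrite <- Rinv_1; apply Rinv_le_contravar; [lra|].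
      rewrite S_INR; pose proof (pos_INR k); lra. }
    assert (0 <= 2 * total (fun _ => 1%nat) / M).
    { apply Rmult_le_pos; [unfold total; simpl INR; lra|now apply Rlt_le, Rinv_0_lt_compat]. }
    unfold point in *; lra. }
  destruct HC as [C HC].
  destruct (cells_top_degree cs n r C Hr HC) as [f [Hf Lf]].
  exists (fun N => / M ^ n * f N); split.
  { apply cone_scal; [now apply Rlt_le, Rinv_0_lt_compat|exact Hf]. }
  intros N.
  assert (Lf' : is_lim_seq (fun k => INR (cell_sum cs (dilate k r N)) / (M * INR (S k)) ^ n)
    (/ M ^ n * f N)).
  { eapply is_lim_seq_ext; [|apply is_lim_seq_mult'; [apply (is_lim_seq_const (/ M ^ n))|apply (Lf N)]].
    intros k; cbv beta. assert (INR (S k) ^ n <> 0) by (apply pow_nonzero, Rgt_not_eq, INR_S_pos).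
    rewrite Rpow_mult_distr. field; split; [assumption|lra]. }
  split.
  - apply (lim_le_const _ _ _ Lf'); intros k.
    destruct (Hcs (dilate k r N)) as [zs [_ [Hz <-]]].
    now apply volume_le_count with g r.
  - intros bs H1 H2.
    destruct (count_le_cover n M B g N r HM Hg HB Hne Hc) as [E [HE H]].
    match goal with |- ?x <= ?y => change (Rbar_le x y) end.
    apply (is_lim_seq_le _ (fun k => lsum (fun ab => prodn n (fun i =>
       snd ab i - fst ab i + 2 * total N / M + E / INR (S k))) bs) _ _) with (2 := Lf').
    + intros k; destruct (Hcs (dilate k r N)) as [zs [Hnd [Hz <-]]].
      apply H; auto. intros z; apply Hz.
    + apply lim_lsum; intros ab _; apply lim_prodn; intros i _; apply lim_affine_div.
Qed.

(* Minkowski's theorem; nonnegativity of the coefficients is part of [cone]. *)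
Theorem volume_comb_polynomial n B :
  (forall t, bounded n (B t)) -> (forall t, exists x, B t x) -> (forall t, convex (B t)) ->
  cone (monos n) (fun N => volume n (comb B N)).
Proof.
  intros HB Hne Hc.
  destruct (choice (fun m f => cone (monos n) f /\ forall N, volume n (comb B N) <= f N /\
    forall bs, Forall (box_ok n) bs -> covers n bs (comb B N) ->
    f N <= lsum (fun ab => prodn n (fun i => snd ab i - fst ab i + 2 * total N / INR (S m))) bs))
    as [f Hf].
  { intros m; apply volume_comb_approx; auto. apply INR_S_pos. }
  apply (cone_closed (monos n) (fun _ => 1%nat) f).
  - intros g Hg; apply in_monos in Hg; destruct Hg as (i & j & l & _ & ->).
    unfold mono; simpl INR; rewrite !pow1; lra.
  - intros m; apply Hf.
  - intros N; apply is_lim_seq_spec; intros eps.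
    destruct (volume_cover_approx n (comb B N) eps) as [bs [H1 [H2 H3]]];
      [now apply comb_bounded|apply cond_pos|].
    pose proof (boxes_vol_enlarge_lim n bs (2 * total N)) as HL.
    apply is_lim_seq_spec in HL.
    (* The slack of a near-optimal cover absorbs its widening once the mesh is fine. *)
    assert (Hd : 0 < volume n (comb B N) + eps - boxes_vol n bs) by lra.
    destruct (HL (mkposreal _ Hd)) as [m0 Hm]; exists m0; intros m Hmm.
    specialize (Hm m Hmm); cbn [pos] in Hm. destruct (Hf m) as [_ Hfm].
    destruct (Hfm N) as [H4 H5]. specialize (H5 bs H1 H2).
    apply Rabs_lt_between in Hm; apply Rabs_lt_between.
    pose proof (cond_pos eps). lra.
Qed.

(** * Mixed volumes as coefficients *)

Lemma pset_ext (K L : pset) : (forall x, K x <-> L x) -> K = L.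
Proof.
  intros H; apply functional_extensionality; intros x; now apply propositional_extensionality.
Qed.

Lemma msum_assoc K L M : msum (msum K L) M = msum K (msum L M).
Proof.
  apply pset_ext; intros x; split.
  - intros (y & z & (y1 & y2 & H1 & H2 & ->) & Hz & ->).
    exists y1, (padd y2 z); split; [exact H1|split; [exists y2, z; auto|]].
    apply functional_extensionality; intros i; unfold padd; ring.
  - intros (y & z & Hy & (z1 & z2 & H1 & H2 & ->) & ->).
    exists (padd y z1), z2; split; [exists y, z1; auto|split; [exact H2|]].
    apply functional_extensionality; intros i; unfold padd; ring.
Qed.

Section Combinations.

Variable B : tri -> pset.
Hypothesis B_nonempty : forall t, exists x, B t x.
Hypothesis B_convex : forall t, convex (B t).

Lemma comb_zero : comb B (fun _ => O) = singleton0.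
Proof.
  apply pset_ext; intros x; unfold singleton0; split.
  - intros [p [_ ->]]; apply functional_extensionality; intros i.
    unfold comb_pt, origin; cbn [INR]; ring.
  - intros ->; destruct (choice _ B_nonempty) as [p Hp]; exists p; split; [exact Hp|].
    apply functional_extensionality; intros i; unfold comb_pt, origin; cbn [INR]; ring.
Qed.

Lemma msum_comb N t : msum (comb B N) (B t) = comb B (inc t N).
Proof.
  apply pset_ext; intros x; split.
  - intros (y & q & [p [Hp ->]] & Hq & ->).
    destruct (comb_absorb B N t p q B_convex Hp Hq) as [p' [Hp' E]].
    exists p'; split; [exact Hp'|]. apply functional_extensionality; intros i; now rewrite E.
  - intros [p [Hp ->]]; exists (comb_pt N p), (p t); split; [exists p; auto|split; [apply Hp|]].
    apply functional_extensionality; intros i; apply comb_pt_inc.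
Qed.

Lemma msum_comb_comb N N' : msum (comb B N) (comb B N') = comb B (fun i => N i + N' i)%nat.
Proof.
  revert N'; apply tri_nat_ind.
  - rewrite comb_zero. replace (fun i => (N i + 0)%nat) with N.
    + apply pset_ext; intros x; split.
      * intros (y & z & Hy & -> & ->). replace (padd y origin) with y; [exact Hy|].
        apply functional_extensionality; intros i; unfold padd, origin; ring.
      * intros Hx; exists x, origin; split; [exact Hx|split; [reflexivity|]].
        apply functional_extensionality; intros i; unfold padd, origin; ring.
    + apply functional_extensionality; intros i; lia.
  - intros N' t IH. rewrite <- msum_comb, <- msum_assoc, IH, msum_comb. f_equal.
    apply functional_extensionality; intros i; unfold inc; destruct (tri_eqb t i); lia.
Qed.

End Combinations.

Definition tr (x y z : nat) : tri -> nat :=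
  fun t => match t with T1 => x | T2 => y | T3 => z end.

Lemma inc_tr x y z : inc T1 (tr x y z) = tr (S x) y z /\ inc T2 (tr x y z) = tr x (S y) z /\
  inc T3 (tr x y z) = tr x y (S z).
Proof. repeat split; apply functional_extensionality; intros []; reflexivity. Qed.

(** * Iterated differences and the polarization formula *)

Fixpoint fd (m : nat) (g : nat -> R) (z : nat) : R :=
  match m with O => g z | S m => fd m g (S z) - fd m g z end.

Lemma fd_ext m g h z : (forall z, g z = h z) -> fd m g z = fd m h z.
Proof. intros H; revert z; induction m as [|m IH]; intros z; simpl; [auto|now rewrite !IH]. Qed.

Lemma fd_plus m g h z : fd m (fun z => g z + h z) z = fd m g z + fd m h z.
Proof. revert z; induction m as [|m IH]; intros z; simpl; [auto|rewrite !IH; ring]. Qed.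

Lemma fd_scal m c g z : fd m (fun z => c * g z) z = c * fd m g z.
Proof. revert z; induction m as [|m IH]; intros z; simpl; [auto|rewrite !IH; ring]. Qed.

Lemma fd_const m c z : fd (S m) (fun _ => c) z = 0.
Proof.
  revert z; induction m as [|m IH]; intros z; [simpl; ring|].
  change (fd (S m) (fun _ => c) (S z) - fd (S m) (fun _ => c) z = 0). rewrite !IH; ring.
Qed.

(** Leibniz rule for forward differences; only two terms appear since the second difference of z
    vanishes. *)
Lemma fd_id_mult m g z :
  fd (S m) (fun z => INR z * g z) z = INR z * fd (S m) g z + INR (S m) * fd m g (S z).
Proof.
  revert z; induction m as [|m IH]; intros z.
  - cbn [fd]; rewrite S_INR; cbn [INR]; ring.
  - change (fd (S (S m)) (fun z => INR z * g z) z) with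
      (fd (S m) (fun z => INR z * g z) (S z) - fd (S m) (fun z => INR z * g z) z).
    rewrite !IH. cbn [fd]. rewrite !S_INR; ring.
Qed.

Lemma fd_pow l : (forall m z, (l < m)%nat -> fd m (fun z => INR z ^ l) z = 0) /\
  (forall z, fd l (fun z => INR z ^ l) z = INR (fact l)).
Proof.
  induction l as [|l [IH1 IH2]].
  - split; [|reflexivity]. intros [|m] z Hm; [lia|]. apply (fd_const m 1).
  - split.
    + intros [|m] z Hm; [lia|].
      change (fun z => INR z ^ S l) with (fun z => INR z * INR z ^ l).
      rewrite (fd_id_mult m (fun z => INR z ^ l)), !IH1 by lia; ring.
    + intros z. change (fun z => INR z ^ S l) with (fun z => INR z * INR z ^ l).
      rewrite (fd_id_mult l (fun z => INR z ^ l)), IH1, IH2 by lia.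
      change (fact (S l)) with (S l * fact l)%nat. rewrite mult_INR; ring.
Qed.

(** Order [m] kills the powers of z below [m] but not those above; these numbers are therefore used
    only in combinations over x and y in which the higher powers cancel. *)
Definition top_fd (m : nat) (F : (tri -> nat) -> R) (x y : nat) : R :=
  fd m (fun z => F (tr x y z)) 0.

Section Polarization.

Variables (n : nat) (B : tri -> pset).
Hypothesis B_nonempty : forall t, exists x, B t x.
Hypothesis B_convex : forall t, convex (B t).

Let F (N : tri -> nat) : R := volume n (comb B N).

(** Each copy of the third body is either added or skipped with a change of sign, which is one
    forward difference in z. *)
Lemma mv_aux_repeat m x y z k :
  mv_aux n (repeat (B T3) m) (comb B (tr x y z)) k = (-1) ^ k * fd m (fun z => F (tr x y z)) z.
Proof.
  revert z k; induction m as [|m IH]; intros z k; [reflexivity|].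
  cbn [repeat mv_aux fd]. rewrite msum_comb by assumption.
  destruct (inc_tr x y z) as (_ & _ & ->). rewrite !IH; simpl; ring.
Qed.

Lemma tr_zero : singleton0 = comb B (tr 0 0 0).
Proof.
  rewrite <- (comb_zero B B_nonempty); f_equal.
  apply functional_extensionality; intros []; reflexivity.
Qed.

Lemma mixed_volume_1 m : mixed_volume n (B T1 :: repeat (B T3) m) =
  / INR (fact n) * (top_fd m F 1 0 - top_fd m F 0 0).
Proof.
  unfold mixed_volume; f_equal; cbn [mv_aux]. rewrite tr_zero, msum_comb by assumption.
  destruct (inc_tr 0 0 0) as (-> & _ & _). rewrite !mv_aux_repeat; unfold top_fd; ring.
Qed.

Lemma mixed_volume_2 m : mixed_volume n (B T2 :: repeat (B T3) m) =
  / INR (fact n) * (top_fd m F 0 1 - top_fd m F 0 0).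
Proof.
  unfold mixed_volume; f_equal; cbn [mv_aux]. rewrite tr_zero, msum_comb by assumption.
  destruct (inc_tr 0 0 0) as (_ & -> & _). rewrite !mv_aux_repeat; unfold top_fd; ring.
Qed.

Lemma mixed_volume_12 m : mixed_volume n (B T1 :: B T2 :: repeat (B T3) m) =
  / INR (fact n) * (top_fd m F 1 1 - top_fd m F 1 0 - top_fd m F 0 1 + top_fd m F 0 0).
Proof.
  unfold mixed_volume; f_equal; cbn [mv_aux].
  rewrite tr_zero, !(msum_comb B B_convex _ T1).
  destruct (inc_tr 0 0 0) as (-> & _ & _). rewrite !(msum_comb B B_convex _ T2).
  destruct (inc_tr 0 0 0) as (_ & -> & _). destruct (inc_tr 1 0 0) as (_ & -> & _).
  rewrite !mv_aux_repeat; unfold top_fd; ring.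
Qed.

End Polarization.

(* For [F] homogeneous of degree [p + 2] in [(x, y, z)], the numbers [a, b, b', c] are the
   coefficients of [z^(p+2)], [x z^(p+1)], [y z^(p+1)] and [x y z^p]. *)
Definition expansion (p : nat) (F : (tri -> nat) -> R) (a b b' c : R) : Prop :=
  (0 <= a /\ 0 <= b /\ 0 <= b' /\ 0 <= c) /\
  (forall z, F (tr 0 0 z) = a * INR z ^ S (S p)) /\
  top_fd (S p) F 1 0 - top_fd (S p) F 0 0 = b * INR (fact (S p)) /\
  top_fd (S p) F 0 1 - top_fd (S p) F 0 0 = b' * INR (fact (S p)) /\
  top_fd p F 1 1 - top_fd p F 1 0 - top_fd p F 0 1 + top_fd p F 0 0 = c * INR (fact p) /\
  (forall x y, exists E, 0 <= E /\ forall z, (1 <= z)%nat ->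
     F (tr x y z) <= a * INR z ^ S (S p) + (b * INR x + b' * INR y) * INR z ^ S p + E * INR z ^ p) /\
  (forall x y z,
     a * INR z ^ S (S p) + (b * INR x + b' * INR y) * INR z ^ S p
       + c * (INR x * INR y) * INR z ^ p <= F (tr x y z)).

Lemma expansion_plus p F F' a b b' c a1 b1 b1' c1 :
  expansion p F a b b' c -> expansion p F' a1 b1 b1' c1 ->
  expansion p (fun N => F N + F' N) (a + a1) (b + b1) (b' + b1') (c + c1).
Proof.
  intros ((Ha & Hb & Hb' & Hc) & H1 & H2 & H3 & H4 & H5 & H6)
         ((Ha1 & Hb1 & Hb1' & Hc1) & I1 & I2 & I3 & I4 & I5 & I6).
  assert (E : forall m x y, top_fd m (fun N => F N + F' N) x y = top_fd m F x y + top_fd m F' x y)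
    by (intros; apply (fd_plus m (fun z => F (tr x y z)) (fun z => F' (tr x y z)))).
  repeat split; try lra.
  - intros z; rewrite H1, I1; ring.
  - rewrite !E; lra.
  - rewrite !E; lra.
  - rewrite !E; lra.
  - intros x y; destruct (H5 x y) as [e [He H]], (I5 x y) as [e' [He' H']].
    exists (e + e'); split; [lra|]. intros z Hz; specialize (H z Hz); specialize (H' z Hz). nra.
  - intros x y z; specialize (H6 x y z); specialize (I6 x y z). nra.
Qed.

Lemma top_fd_mono c m i j l x y :
  top_fd m (fun N => c * mono i j l N) x y =
  c * (INR x ^ i * INR y ^ j) * fd m (fun z => INR z ^ l) 0.
Proof.
  unfold top_fd; rewrite <- fd_scal; apply fd_ext; intros z; unfold mono, tr; ring.
Qed.

(** Only monomials with i and j at most 1 contribute to the four numbers. Every other one has l <=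
    p: it goes into the error [E] of the upper bound and is dropped from the lower bound by its
    sign. *)
Lemma expansion_mono p c i j l : 0 <= c -> (i + j + l = S (S p))%nat ->
  exists a b b' d, expansion p (fun N => c * mono i j l N) a b b' d.
Proof.
  intros Hc Hl.
  assert (Z : forall m, (l < m)%nat -> fd m (fun z => INR z ^ l) 0 = 0)
    by (intros; now apply fd_pow).
  assert (Zl : fd l (fun z => INR z ^ l) 0 = INR (fact l)) by apply fd_pow.
  assert (P0 : forall k, INR 0 ^ S k = 0) by (intros k; simpl; ring).
  assert (P1 : forall k, INR 1 ^ k = 1) by (intros k; apply pow1).
  assert (Other : (l <= p)%nat -> (i = 0 \/ j = 0 \/ l < p)%nat ->
    exists a b b' d, expansion p (fun N => c * mono i j l N) a b b' d).
  { intros Hlp Hij; exists 0, 0, 0, 0.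
    assert (Hpos : forall x y z, 0 <= c * mono i j l (tr x y z)).
    { intros; unfold mono, tr; repeat apply Rmult_le_pos; auto; apply pow_le, pos_INR. }
    repeat split; try lra.
    - intros z; unfold mono, tr.
      destruct i; [destruct j; [lia|]|]; rewrite P0; ring.
    - rewrite !top_fd_mono, Z by lia; ring.
    - rewrite !top_fd_mono, Z by lia; ring.
    - rewrite !top_fd_mono, !P1.
      destruct Hij as [->|[->|Hlt]].
      + destruct j; [lia|]. rewrite P0; simpl; ring.
      + destruct i; [lia|]. rewrite P0; simpl; ring.
      + rewrite Z by lia; ring.
    - intros x y; exists (c * (INR x ^ i * INR y ^ j)).
      assert (Hxy : 0 <= c * (INR x ^ i * INR y ^ j))
        by (repeat apply Rmult_le_pos; auto; apply pow_le, pos_INR).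
      split; [exact Hxy|]. intros z Hz; unfold mono, tr.
      apply Rle_trans with (c * (INR x ^ i * INR y ^ j) * INR z ^ l); [right; ring|].
      apply Rle_trans with (c * (INR x ^ i * INR y ^ j) * INR z ^ p); [|right; ring].
      (* Here z >= 1 matters: lower powers of z are absorbed into z^p. *)
      apply Rmult_le_compat_l; [exact Hxy|]. apply Rle_pow; [|lia].
      change 1 with (INR 1); now apply le_INR.
    - intros x y z; specialize (Hpos x y z). lra. }
  destruct (le_lt_dec i 1) as [Hi|Hi]; [|apply Other; lia].
  destruct (le_lt_dec j 1) as [Hj|Hj]; [|apply Other; lia].
  assert (Hcases : (i = 0 /\ j = 0 \/ i = 1 /\ j = 0 \/ i = 0 /\ j = 1 \/ i = 1 /\ j = 1)%nat) by lia.
  destruct Hcases as [[-> ->]|[[-> ->]|[[-> ->]|[-> ->]]]].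
  - exists c, 0, 0, 0. assert (l = S (S p)) by lia; subst l.
    repeat split; try lra.
    + intros z; unfold mono, tr; simpl; ring.
    + rewrite !top_fd_mono; simpl pow; ring.
    + rewrite !top_fd_mono; simpl pow; ring.
    + rewrite !top_fd_mono; simpl pow; ring.
    + intros x y; exists 0; split; [lra|]. intros z _; unfold mono, tr. simpl pow; lra.
    + intros x y z; unfold mono, tr; simpl pow; lra.
  - exists 0, c, 0, 0. assert (l = S p) by lia; subst l.
    repeat split; try lra.
    + intros z; unfold mono, tr; simpl; ring.
    + rewrite !top_fd_mono, Zl; simpl pow; simpl (INR 0); simpl (INR 1); ring.
    + rewrite !top_fd_mono; simpl pow; simpl (INR 0); ring.
    + rewrite !top_fd_mono; simpl pow; simpl (INR 0); ring.
    + intros x y; exists 0; split; [lra|]. intros z _; unfold mono, tr. simpl pow; lra.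
    + intros x y z; unfold mono, tr; simpl pow; lra.
  - exists 0, 0, c, 0. assert (l = S p) by lia; subst l.
    repeat split; try lra.
    + intros z; unfold mono, tr; simpl; ring.
    + rewrite !top_fd_mono; simpl pow; simpl (INR 0); ring.
    + rewrite !top_fd_mono, Zl; simpl pow; simpl (INR 0); simpl (INR 1); ring.
    + rewrite !top_fd_mono; simpl pow; simpl (INR 0); ring.
    + intros x y; exists 0; split; [lra|]. intros z _; unfold mono, tr. simpl pow; lra.
    + intros x y z; unfold mono, tr; simpl pow; lra.
  - exists 0, 0, 0, c. assert (l = p) by lia; subst l.
    repeat split; try lra.
    + intros z; unfold mono, tr; simpl; ring.
    + rewrite !top_fd_mono; simpl pow; simpl (INR 0); ring.
    + rewrite !top_fd_mono; simpl pow; simpl (INR 0); ring.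
    + rewrite !top_fd_mono, Zl; simpl pow; simpl (INR 0); simpl (INR 1); ring.
    + intros x y; exists (c * (INR x * INR y)); split.
      * repeat apply Rmult_le_pos; auto; apply pos_INR.
      * intros z _; unfold mono, tr. simpl pow; lra.
    + intros x y z; unfold mono, tr; simpl pow; lra.
Qed.

Lemma cone_expansion p F : cone (monos (S (S p))) F -> exists a b b' c, expansion p F a b b' c.
Proof.
  assert (HL : forall g, In g (monos (S (S p))) -> forall c, 0 <= c ->
    exists a b b' d, expansion p (fun N => c * g N) a b b' d).
  { intros g Hg c Hc; apply in_monos in Hg; destruct Hg as (i & j & l & H & ->).
    now apply expansion_mono. }
  revert F HL; generalize (monos (S (S p))); intros L.
  induction L as [|g L IH]; intros F HL HF.
  (* The zero function, written as 0 times an arbitrary monomial of the right degree. *)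
  - destruct (expansion_mono p 0 2 0 p) as (a & b & b' & d & H); [lra|lia|].
    exists a, b, b', d. replace F with (fun N => 0 * mono 2 0 p N); [exact H|].
    apply functional_extensionality; intros N; simpl in HF; rewrite HF; ring.
  - destruct HF as [c [Hc HF]].
    destruct (IH (fun N => F N - c * g N)) as (a & b & b' & d & H1); [intros; apply HL; simpl; auto|exact HF|].
    destruct (HL g (or_introl eq_refl) c Hc) as (a1 & b1 & b1' & d1 & H2).
    pose proof (expansion_plus _ _ _ _ _ _ _ _ _ _ _ H1 H2) as H.
    do 4 eexists. replace F with (fun N => F N - c * g N + c * g N); [exact H|].
    apply functional_extensionality; intros N; ring.
Qed.

(** * Minkowski's inequalities *)

(** Homogeneous Bernoulli inequality, by induction with the square of v discarded. [v] may be
    negative, as needed for a difference of unknown sign in [minkowski_first]. *)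
Lemma bernoulli k u v : 0 <= u -> 0 <= u + v ->
  u ^ S k + INR (S k) * v * u ^ k <= (u + v) ^ S k.
Proof.
  intros Hu Huv; induction k as [|k IH]; [cbn [pow INR]; lra|].
  rewrite <- (tech_pow_Rmult (u + v)).
  apply Rle_trans with ((u + v) * (u ^ S k + INR (S k) * v * u ^ k));
    [|now apply Rmult_le_compat_l].
  rewrite (S_INR (S k)). cbn [pow].
  assert (0 <= INR (S k) * (v * v) * u ^ k).
  { apply Rmult_le_pos; [|now apply pow_le].
    apply Rmult_le_pos; [apply pos_INR|apply Rle_0_sqr]. }
  nra.
Qed.

(** Binomial expansion to second order, with a remainder uniform on [0,1]; t will be 1/m. *)
Lemma pow_second_order p u v : 0 <= u -> 0 <= v -> exists G, 0 <= G /\ forall t, 0 <= t <= 1 ->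
  (u + v * t) ^ S (S p) <= u ^ S (S p) + INR (S (S p)) * u ^ S p * v * t
    + INR (S (S p)) * INR (S p) / 2 * u ^ p * v ^ 2 * t ^ 2 + G * t ^ 3.
Proof.
  intros Hu Hv; induction p as [|p [G [HG IH]]].
  - exists 0; split; [lra|]. intros t _; cbn [pow INR]; right; field.
  - set (H := INR (S (S p)) * INR (S p) / 2 * u ^ p * v ^ 2).
    assert (HH : 0 <= H).
    { unfold H; repeat apply Rmult_le_pos; try apply pos_INR; try apply pow_le; lra. }
    (* Multiplication by u + v t yields the t^3 coefficient [H * v + G * u] and the t^4 coefficient
       [G * v], which t <= 1 turns into a t^3 term. *)
    exists (H * v + G * u + G * v); split.
    { repeat apply Rplus_le_le_0_compat; now apply Rmult_le_pos. }
    intros t Ht; specialize (IH t Ht).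
    assert (Huvt : 0 <= u + v * t) by (apply Rplus_le_le_0_compat; [|apply Rmult_le_pos]; lra).
    rewrite <- tech_pow_Rmult. eapply Rle_trans; [apply Rmult_le_compat_l; [exact Huvt|exact IH]|].
    fold H.
    assert (Ht4 : G * v * t ^ 4 <= G * v * t ^ 3).
    { apply Rmult_le_compat_l; [now apply Rmult_le_pos|].
      change (t ^ 4) with (t * t ^ 3). rewrite <- (Rmult_1_l (t ^ 3)) at 2.
      apply Rmult_le_compat_r; [apply pow_le; lra|lra]. }
    match goal with |- ?l <= ?r => replace l with (r - G * v * t ^ 3 + G * v * t ^ 4); [lra|] end.
    unfold H; rewrite !S_INR; cbn [pow]; field.
Qed.

Section SecondInequality.

Variables (p : nat) (F : (tri -> nat) -> R) (a b b' c alpha : R).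
Hypothesis F_expansion : expansion p F a b b' c.
Hypothesis alpha_pos : 0 < alpha.
Hypothesis alpha_root : alpha ^ S (S p) = a.
Hypothesis F_superadditive : forall x y z j beta, 0 <= beta -> beta ^ S (S p) = F (tr x y z) ->
  (INR j * alpha + beta) ^ S (S p) <= F (tr x y (j + z)).

(** For L = x K1 + y K2 + z A one has n V(L, A[n-1]) = q + n z a with q the right-hand side. Moving
    n z a across brings the first inequality into this form. *)
Lemma minkowski_first x y z beta : 0 <= beta -> beta ^ S (S p) = F (tr x y z) ->
  INR (S (S p)) * (beta - INR z * alpha) * alpha ^ S p <= b * INR x + b' * INR y.
Proof.
  intros Hb Eb. destruct F_expansion as (_ & _ & _ & _ & _ & H5 & _).
  destruct (H5 x y) as [E [HE H]]; clear H5.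
  set (q := b * INR x + b' * INR y) in *.
  apply (lim_le_const (fun k => q + E / INR (S k)) q); [apply lim_affine_div|]. intros k.
  set (J := (S k + z)%nat).
  assert (HJ : 0 < INR J) by (apply lt_0_INR; unfold J; lia).
  specialize (H J ltac:(unfold J; lia)).
  pose proof (F_superadditive x y z (S k) beta Hb Eb) as HF. fold J in HF.
  pose proof (bernoulli (S p) (INR J * alpha) (beta - INR z * alpha)) as HB.
  assert (EJ : INR J * alpha + (beta - INR z * alpha) = INR (S k) * alpha + beta).
  { unfold J; rewrite plus_INR; ring. }
  rewrite EJ in HB.
  assert (H0 : 0 <= INR (S k) * alpha).
  { apply Rmult_le_pos; [apply pos_INR|lra]. }
  assert (HB' : (INR J * alpha) ^ S (S p) +
      INR (S (S p)) * (beta - INR z * alpha) * (INR J * alpha) ^ S p <=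
      (INR (S k) * alpha + beta) ^ S (S p)).
  { apply HB; [apply Rmult_le_pos|]; lra. }
  rewrite !Rpow_mult_distr, alpha_root in HB'.
  assert (HJp : 0 < INR J ^ p) by now apply pow_lt.
  assert (Hmain : INR (S (S p)) * (beta - INR z * alpha) * alpha ^ S p * INR J <= q * INR J + E).
  (* The terms a J^n on both sides cancel, and the common factor J^p is divided out. *)
  { apply Rmult_le_reg_r with (INR J ^ p); [exact HJp|].
    assert (EJp : INR J ^ S p = INR J * INR J ^ p) by reflexivity.
    rewrite EJp in *. nra. }
  apply Rle_trans with (q + E / INR J).
  - apply Rmult_le_reg_r with (INR J); [exact HJ|].
    replace ((q + E / INR J) * INR J) with (q * INR J + E) by (field; lra). exact Hmain.
  - apply Rplus_le_compat_l, Rmult_le_compat_l; [exact HE|].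
    apply Rinv_le_contravar; [apply INR_S_pos|]. apply le_INR; unfold J; lia.
Qed.

(** The first inequality bounds the n-th root of F(x, y, m) by m alpha + v with v independent of m.
    In the n-th power the two leading coefficients in m match those of the lower bound for F, so the
    coefficients of m^p are comparable. *)
Lemma minkowski_second x y :
  2 * INR (S (S p)) * a * c * (INR x * INR y) <= INR (S p) * (b * INR x + b' * INR y) ^ 2.
Proof.
  destruct F_expansion as ((Ha & Hb & Hb' & Hc) & _ & _ & _ & _ & _ & H6).
  specialize (H6 x y).
  pose proof (minkowski_first x y) as Hfirst.
  set (q := b * INR x + b' * INR y) in *.
  assert (Hq : 0 <= q) by (apply Rplus_le_le_0_compat; apply Rmult_le_pos; auto; apply pos_INR).
  set (n1 := INR (S p)). set (n2 := INR (S (S p))) in *.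
  assert (Hn1 : 0 < n1) by apply INR_S_pos. assert (Hn2 : 0 < n2) by apply INR_S_pos.
  set (w := alpha ^ S p) in *. assert (Hw : 0 < w) by now apply pow_lt.
  (* The largest excess of the root over m alpha that the first inequality allows. *)
  set (v := q / (n2 * w)).
  assert (Hnw : 0 < n2 * w) by now apply Rmult_lt_0_compat.
  assert (Hv : 0 <= v) by (apply Rmult_le_pos; [exact Hq|now apply Rlt_le, Rinv_0_lt_compat]).
  destruct (pow_second_order p alpha v) as [G [HG Hexp]]; [lra|exact Hv|].
  assert (Hlim : c * (INR x * INR y) <= n2 * n1 / 2 * alpha ^ p * v ^ 2).
  { apply (lim_le_const (fun k => n2 * n1 / 2 * alpha ^ p * v ^ 2 + G / INR (S k)));
      [apply lim_affine_div|]. intros k.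
    set (m := INR (S k)). assert (Hm : 0 < m) by apply INR_S_pos.
    assert (Hmp : 0 < m ^ p) by now apply pow_lt.
    assert (Hmi : 0 < / m) by now apply Rinv_0_lt_compat.
    assert (HFn : 0 <= F (tr x y (S k))).
    { eapply Rle_trans; [|apply H6]. fold m.
      repeat apply Rplus_le_le_0_compat; repeat apply Rmult_le_pos; auto;
        try apply pow_le; try apply pos_INR; lra. }
    destruct (nth_root_exists (S (S p)) _ ltac:(lia) HFn) as [beta [Hbeta Ebeta]].
    specialize (Hfirst (S k) beta Hbeta Ebeta). fold m in Hfirst.
    assert (Hbv : beta <= m * (alpha + v * / m)).
    { replace (m * (alpha + v * / m)) with (m * alpha + v) by (field; lra).
      assert (beta - m * alpha <= v); [|lra].
      apply Rmult_le_reg_r with (n2 * w); [exact Hnw|].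
      unfold v; unfold Rdiv; rewrite Rmult_assoc, Rinv_l by lra. lra. }
    assert (Hup : F (tr x y (S k)) <= m ^ S (S p) * (alpha + v * / m) ^ S (S p)).
    { rewrite <- Ebeta, <- Rpow_mult_distr. apply pow_incr; lra. }
    assert (Hm1 : 0 <= / m <= 1).
    { split; [lra|]. rewrite <- Rinv_1; apply Rinv_le_contravar; [lra|].
      unfold m; rewrite S_INR; pose proof (pos_INR k); lra. }
    specialize (Hexp (/ m) Hm1). fold n1 n2 w in Hexp. rewrite alpha_root in Hexp.
    specialize (H6 (S k)). fold m in H6.
    assert (Hm2 : 0 < m ^ S (S p)) by now apply pow_lt.
    apply (Rmult_le_compat_l (m ^ S (S p))) in Hexp; [|lra].
    assert (Eq : n2 * w * v = q) by (unfold v; field; lra).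
    rewrite Eq in Hexp.
    (* By [alpha_root] and n w v = q, the first two terms are exactly those in [H6] and cancel. *)
    assert (Eexp : m ^ S (S p) * (a + q * / m + n2 * n1 / 2 * alpha ^ p * v ^ 2 * (/ m) ^ 2 +
       G * (/ m) ^ 3) = a * m ^ S (S p) + q * m ^ S p +
       (n2 * n1 / 2 * alpha ^ p * v ^ 2 + G / m) * m ^ p) by (cbn [pow]; field; lra).
    rewrite Eexp in Hexp.
    apply Rmult_le_reg_r with (m ^ p); [exact Hmp|]. lra. }
  apply (Rmult_le_compat_l (2 * n2 * a)) in Hlim;
    [|repeat apply Rmult_le_pos; lra].
  apply Rle_trans with (2 * n2 * a * (c * (INR x * INR y))); [right; ring|].
  eapply Rle_trans; [apply Hlim|]. right.
  rewrite <- alpha_root. unfold v, w. cbn [pow]. field.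
  assert (0 < alpha ^ p) by now apply pow_lt. lra.
Qed.

End SecondInequality.

Lemma INR_ceil r : 0 <= r -> exists x, r <= INR x <= r + 1.
Proof.
  intros Hr; destruct (nfloor_ex r Hr) as [x Hx]; exists (S x).
  rewrite S_INR; lra.
Qed.

(** The best ratio x : y = Q : P need not be rational, so x and y are taken as integers just above T
    Q and T P with T growing. If P or Q is 0, one variable drops out of the right side and e <= 0
    follows. *)
Lemma discriminant_bound e D P Q : 0 <= D -> 0 <= P -> 0 <= Q ->
  (forall x y, e * (INR x * INR y) <= D * (P * INR x + Q * INR y) ^ 2) -> e <= 4 * D * (P * Q).
Proof.
  intros HD HP HQ H.
  assert (Degenerate : forall C, (forall x, e * INR x <= C) -> e <= 0).
  { intros C HC. apply (lim_le_const (fun k => C / INR (S k)) 0); [apply lim_const_div|].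
    intros k; pose proof (INR_S_pos k). apply Rmult_le_reg_r with (INR (S k)); [easy|].
    unfold Rdiv; rewrite Rmult_assoc, Rinv_l by lra. specialize (HC (S k)); lra. }
  destruct (Rle_lt_dec e 0) as [He|He].
  { eapply Rle_trans; [exact He|]. repeat apply Rmult_le_pos; lra. }
  destruct HP as [HP|<-].
  2:{ exfalso. assert (e <= 0); [|lra]. apply (Degenerate (D * Q ^ 2)); intros x.
      specialize (H x 1%nat). simpl (INR 1) in H. nra. }
  destruct HQ as [HQ|<-].
  2:{ exfalso. assert (e <= 0); [|lra]. apply (Degenerate (D * P ^ 2)); intros x.
      specialize (H 1%nat x). simpl (INR 1) in H. nra. }
  assert (HPQ : 0 < P * Q) by now apply Rmult_lt_0_compat.
  apply Rmult_le_reg_r with (P * Q); [exact HPQ|].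
  apply (lim_le_const (fun k => D * ((2 * (P * Q) + (P + Q) / INR (S k)) *
    (2 * (P * Q) + (P + Q) / INR (S k))))).
  - replace (Finite (4 * D * (P * Q) * (P * Q)))
      with (Finite (D * ((2 * (P * Q)) * (2 * (P * Q))))) by (f_equal; ring).
    apply is_lim_seq_mult'; [apply is_lim_seq_const|].
    apply is_lim_seq_mult'; apply lim_affine_div.
  - intros k. set (T := INR (S k)). assert (HT : 0 < T) by apply INR_S_pos.
    destruct (INR_ceil (T * Q)) as [x Hx]; [apply Rmult_le_pos; lra|].
    destruct (INR_ceil (T * P)) as [y Hy]; [apply Rmult_le_pos; lra|].
    specialize (H x y).
    apply Rmult_le_reg_r with (T * T); [now apply Rmult_lt_0_compat|].
    apply Rle_trans with (e * (INR x * INR y)).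
    + replace (e * (P * Q) * (T * T)) with (e * ((T * Q) * (T * P))) by ring.
      apply Rmult_le_compat_l; [lra|].
      apply Rmult_le_compat; try lra; apply Rmult_le_pos; lra.
    + eapply Rle_trans; [exact H|].
      replace (D * ((2 * (P * Q) + (P + Q) / T) * (2 * (P * Q) + (P + Q) / T)) * (T * T))
        with (D * (P * (T * Q + 1) + Q * (T * P + 1)) ^ 2) by (field; lra).
      apply Rmult_le_compat_l; [exact HD|]. apply pow_incr; split.
      * apply Rplus_le_le_0_compat; apply Rmult_le_pos; try lra; apply pos_INR.
      * apply Rplus_le_compat; apply Rmult_le_compat_l; lra.
Qed.

Theorem theorem1p5 (n : nat) (A K1 K2 : pset) :
  (2 <= n)%nat ->
  convex_body n A -> convex_body n K1 -> convex_body n K2 ->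
  volume n A * mixed_volume n (K1 :: K2 :: repeat A (n - 2))
  <= 2 * mixed_volume n (K1 :: repeat A (n - 1))
       * mixed_volume n (K2 :: repeat A (n - 1)).
Proof.
  intros Hn (_ & NA & CA & BA & _) (_ & N1 & C1 & B1 & _) (_ & N2 & C2 & B2 & _).
  destruct n as [|[|p]]; [lia|lia|].
  replace (S (S p) - 2)%nat with p by lia. replace (S (S p) - 1)%nat with (S p) by lia.
  set (B := fun t => match t with T1 => K1 | T2 => K2 | T3 => A end).
  assert (HB : forall t, bounded (S (S p)) (B t)) by (intros []; assumption).
  assert (HN : forall t, exists x, B t x) by (intros []; assumption).
  assert (HC : forall t, convex (B t)) by (intros []; assumption).
  set (F := fun N => volume (S (S p)) (comb B N)).
  destruct (cone_expansion p F (volume_comb_polynomial _ B HB HN HC)) as (a & b & b' & c & HF).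
  pose proof HF as ((Ha & Hb & Hb' & Hc) & H1 & H2 & H3 & H4 & _ & _).
  pose proof (mixed_volume_12 (S (S p)) B HN HC p) as M12. fold F in M12. rewrite H4 in M12.
  pose proof (mixed_volume_1 (S (S p)) B HN HC (S p)) as M1. fold F in M1. rewrite H2 in M1.
  pose proof (mixed_volume_2 (S (S p)) B HN HC (S p)) as M2. fold F in M2. rewrite H3 in M2.
  simpl B in M12, M1, M2. rewrite M12, M1, M2; clear M12 M1 M2.
  assert (VA : volume (S (S p)) A = a).
  { transitivity (F (tr 0 0 1)); [|rewrite H1; simpl INR; rewrite pow1; ring].
    unfold F; f_equal; apply pset_ext; intros x; split.
    (* A zero weight in [comb] still asks for a point of that body. *)
    - intros Hx. destruct N1 as [x1 Hx1], N2 as [x2 Hx2].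
      exists (fun t => match t with T1 => x1 | T2 => x2 | T3 => x end).
      split; [intros []; assumption|].
      apply functional_extensionality; intros i; unfold comb_pt, tr; simpl INR; ring.
    - intros [q [Hq ->]]. replace (comb_pt (tr 0 0 1) q) with (q T3); [apply (Hq T3)|].
      apply functional_extensionality; intros i; unfold comb_pt, tr; simpl INR; ring. }
  rewrite VA.
  set (n1 := INR (S p)). set (n2 := INR (S (S p))). set (fp := INR (fact p)).
  assert (Hn1 : 0 < n1) by apply INR_S_pos. assert (Hn2 : 0 < n2) by apply INR_S_pos.
  assert (Hfp : 0 < fp) by (apply lt_0_INR, lt_O_fact).
  assert (E1 : INR (fact (S p)) = n1 * fp) by (change (fact (S p)) with (S p * fact p)%nat; apply mult_INR).
  assert (E2 : INR (fact (S (S p))) = n2 * (n1 * fp)).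
  { rewrite <- E1; change (fact (S (S p))) with (S (S p) * fact (S p))%nat; apply mult_INR. }
  rewrite E2, E1.
  (* Here b = n V(K1,A[n-1]), b' = n V(K2,A[n-1]) and c = n(n-1) V(K1,K2,A[n-2]); these factors turn
     2(n-1)/n into the constant 2. *)
  assert (Main : n2 * a * c <= 2 * n1 * (b * b')).
  (* If |A| = 0 there is no positive alpha to work with, but the left side vanishes and the right
     side is nonnegative. *)
  { destruct Ha as [Ha|Ha].
    2:{ rewrite <- Ha; rewrite Rmult_0_r, Rmult_0_l. repeat apply Rmult_le_pos; lra. }
    destruct (nth_root_exists (S (S p)) a) as [alpha [Hal Eal]]; [lia|lra|].
    assert (Hal' : 0 < alpha) by (destruct Hal as [|<-]; [easy|rewrite pow_ne_zero in Eal by lia; lra]).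
    assert (Hsup : forall x y z j beta, 0 <= beta -> beta ^ S (S p) = F (tr x y z) ->
      (INR j * alpha + beta) ^ S (S p) <= F (tr x y (j + z))).
    { intros x y z j beta Hbeta Ebeta.
      replace (F (tr x y (j + z)))
        with (volume (S (S p)) (msum (comb B (tr 0 0 j)) (comb B (tr x y z)))).
      - apply brunn_minkowski; auto using comb_bounded.
        + lia.
        + apply choice in HN; destruct HN as [q Hq]; exists (comb_pt (tr 0 0 j) q), q; auto.
        + apply choice in HN; destruct HN as [q Hq]; exists (comb_pt (tr x y z) q), q; auto.
        + apply Rmult_le_pos; [apply pos_INR|exact Hal].
        + fold (F (tr 0 0 j)). rewrite H1, Rpow_mult_distr, Eal; ring.
      - unfold F; rewrite msum_comb_comb by assumption.
        apply (f_equal (fun N => volume (S (S p)) (comb B N))).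
        apply functional_extensionality; intros []; reflexivity. }
    assert (HD : 2 * n2 * a * c <= 4 * n1 * (b * b')); [|lra].
    apply discriminant_bound; [lra|exact Hb|exact Hb'|].
    intros x y; apply (minkowski_second p F a b b' c alpha); assumption. }
  apply Rmult_le_reg_r with (n2 * (n2 * n1)); [repeat apply Rmult_lt_0_compat; assumption|].
  replace (a * (/ (n2 * (n1 * fp)) * (c * fp)) * (n2 * (n2 * n1))) with (n2 * a * c)
    by (field; lra).
  replace (2 * (/ (n2 * (n1 * fp)) * (b * (n1 * fp))) * (/ (n2 * (n1 * fp)) * (b' * (n1 * fp)))
    * (n2 * (n2 * n1))) with (2 * n1 * (b * b')) by (field; lra).
  exact Main.
Qed.
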